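(* Let $n\geq 5$. The moduli space of isomorphism classes of noncommutative deformations of a Kleinian singularity of type $D_n$ is isomorphic to a vector space of dimension $n$.
   Context: Write $[x,y]=xy-yx$. The Kleinian singularity of type $D_n$ has coordinate ring $\mathbb{C}[X,Y,Z]/(\phi)$, $\phi=X^{n-1}+XY^2+Z^2$, with the Poisson bracket induced by $\{X,Y\}=\partial\phi/\partial Z$, $\{X,Z\}=-\partial\phi/\partial Y$, $\{Y,Z\}=\partial\phi/\partial X$, graded by $\deg X=4$, $\deg Y=2n-4$, $\deg Z=2n-2$. A noncommutative deformation of it is a filtered associative $\mathbb{C}$-algebra $A$ whose associated graded algebra is isomorphic to this coordinate ring in such a way that the bracket induced by the commutator is the Poisson bracket. For a polynomial $Q(t)\in\mathbb{C}[t]$ of degree $m\ge 3$ and $\gamma\in\mathbb{C}$, let $P(t)$ be the unique polynomial of degree $m-1$ such that $Q(-s(s-1))-Q(-s(s+1))=(s-1)P(-s(s-1))+(s+1)P(-s(s+1))$ in $\mathbb{C}[s]$; $D(Q,\gamma)$ is the associative unital $\mathbb{C}$-algebra with generators $u,v,w$ and relations $[u,v]=2w$, $[u,w]=-2uv+2w+\gamma$, $[v,w]=v^2+P(u)$ and $Q(u)+uv^2+w^2-2wv-\gamma v=0$. The noncommutative deformations of the Kleinian singularity of type $D_n$ are, up to isomorphism, exactly the algebras $D(Q,\gamma)$ with $Q$ monic of degree $n-1$ and $\gamma\in\mathbb{C}$. They are thus parametrised by the affine space of pairs $(Q,\gamma)$ (coordinates: the $n-1$ non-leading coefficients of $Q$,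 and $\gamma$). The moduli space of isomorphism classes is the quotient of this parameter space by the relation $(Q,\gamma)\sim(Q',\gamma')$ iff $D(Q,\gamma)\cong D(Q',\gamma')$ as $\mathbb{C}$-algebras, the regular functions on it being the polynomial functions on the parameter space that are constant on equivalence classes; ''isomorphic to a vector space'' means isomorphic, as an affine variety, to an affine space (i.e. there is a bijection with $\mathbb{C}^n$ identifying the regular functions with the polynomial functions). *)

(* Defs.v *)
From HB Require Import structures.
From mathcomp Require Import all_boot all_order all_algebra.
From mathcomp Require Import generic_quotient ring_quotient.
From mathcomp Require Import boolp classical_sets reals complex.
From mathcomp Require Import monalg.
From mathcomp Require Import zify ring.
(* [mpoly] is not imported: its notations clash with those of [classical_sets]
   and [monalg]. *)
From mathcomp Require mpoly.

Set Implicit Arguments.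
Unset Strict Implicit.
Unset Printing Implicit Defensive.

Import GRing.Theory Num.Theory.
Local Open Scope classical_set_scope.
Local Open Scope ring_scope.
Local Open Scope quotient_scope.

(* Quotient of a (possibly noncommutative) algebra [A] by the two-sided ideal
   generated by [S].  Closure under scalars follows from [IdealM]. *)
Section TwoSidedQuotient.
Variables (K : comNzRingType) (A : lalgType K) (S : set A).

Inductive ideal_gen : A -> Prop :=
| IdealGen x of S x : ideal_gen x
| Ideal0 : ideal_gen 0
| IdealB x y of ideal_gen x & ideal_gen y : ideal_gen (x - y)
| IdealM a x b of ideal_gen x : ideal_gen (a * x * b).

Definition in_ideal : {pred A} := [pred x | `[< ideal_gen x >]].

Fact in_ideal_zmod_closed : zmod_closed in_ideal.
Proof.
split=> [|x y]; first exact/asboolP/Ideal0.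
by move=> /asboolP xI /asboolP yI; apply/asboolP/IdealB.
Qed.

HB.instance Definition _ :=
  GRing.isZmodClosed.Build A in_ideal in_ideal_zmod_closed.

(* [ring_quotient] provides the additive quotient [Quotient.quot], but a ring
   structure on it only for commutative rings. *)
Definition quot_alg : Type := Quotient.quot in_ideal.

HB.instance Definition _ := Choice.copy quot_alg (Quotient.quot in_ideal).
HB.instance Definition _ := GRing.Zmodule.copy quot_alg (Quotient.quot in_ideal).
HB.instance Definition _ :=
  EqQuotient.copy quot_alg (Quotient.quot in_ideal).

Local Notation "\q x" := (\pi_quot_alg x) (at level 2).

Lemma eq_quot_alg x y : (\q x = \q y) <-> ideal_gen (x - y).
Proof.
split=> [/eqP|xyI]; first by rewrite -Quotient.idealrBE => /asboolP.
by apply/eqP; rewrite -Quotient.idealrBE; apply/asboolP.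
Qed.

Lemma pi_quot_algD x y : \q (x + y) = \q x + \q y.
Proof. exact: Quotient.pi_add. Qed.

Let reprI x : ideal_gen (repr (\q x) - x).
Proof. by apply/eq_quot_alg; rewrite reprK. Qed.

Let idealD x y : ideal_gen x -> ideal_gen y -> ideal_gen (x + y).
Proof.
move=> xI yI; rewrite -[y]opprK; apply: IdealB => //.
by rewrite -sub0r; apply: IdealB => //; apply: Ideal0.
Qed.

Definition qone : quot_alg := \q 1.
Definition qmul (x y : quot_alg) : quot_alg := \q (repr x * repr y).
Definition qscale (c : K) (x : quot_alg) : quot_alg := \q (c *: repr x).

Let qM x y : qmul (\q x) (\q y) = \q (x * y).
Proof.
apply/eq_quot_alg; set x' := repr _; set y' := repr _.
have -> : x' * y' - x * y = 1 * (x' - x) * y' + x * (y' - y) * 1.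
    by rewrite mul1r mulr1 mulrBl mulrBr addrA subrK.
by apply: idealD; apply: IdealM; apply: reprI.
Qed.

Let qZ c x : qscale c (\q x) = \q (c *: x).
Proof.
apply/eq_quot_alg; rewrite -scalerBr -[X in c *: X]mul1r scalerAl -[X in ideal_gen X]mulr1.
by apply: IdealM; apply: reprI.
Qed.

Fact qmulA : associative qmul.
Proof. by elim/quotW=> x; elim/quotW=> y; elim/quotW=> z; rewrite (qM x y) (qM y z) !qM mulrA. Qed.
Fact qmul1 : left_id qone qmul.
Proof. by elim/quotW=> x; rewrite qM mul1r. Qed.
Fact qmulr1 : right_id qone qmul.
Proof. by elim/quotW=> x; rewrite qM mulr1. Qed.
Fact qmulDl : left_distributive qmul +%R.
Proof.
by elim/quotW=> x; elim/quotW=> y; elim/quotW=> z; rewrite -pi_quot_algD (qM x) (qM y) qM mulrDl pi_quot_algD.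
Qed.
Fact qmulDr : right_distributive qmul +%R.
Proof.
by elim/quotW=> x; elim/quotW=> y; elim/quotW=> z; rewrite -pi_quot_algD (qM x) (qM x) qM mulrDr pi_quot_algD.
Qed.

HB.instance Definition _ :=
  GRing.Zmodule_isPzRing.Build quot_alg qmulA qmul1 qmulr1 qmulDl qmulDr.

Fact qscaleA a b v : qscale a (qscale b v) = qscale (a * b) v.
Proof. by elim/quotW: v => v; rewrite (qZ b) !qZ scalerA. Qed.
Fact qscale1 : left_id 1 qscale.
Proof. by elim/quotW=> v; rewrite qZ scale1r. Qed.
Fact qscaleDr : right_distributive qscale +%R.
Proof. by move=> a; elim/quotW=> x; elim/quotW=> y; rewrite -pi_quot_algD (qZ a x) (qZ a y) qZ scalerDr pi_quot_algD. Qed.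
Fact qscaleDl v : {morph qscale^~ v : a b / a + b}.
Proof. by move=> a b; elim/quotW: v => v; rewrite (qZ a) (qZ b) qZ scalerDl pi_quot_algD. Qed.

HB.instance Definition _ := GRing.Zmodule_isLmodule.Build K quot_alg
  qscaleA qscale1 qscaleDr qscaleDl.

Lemma pi_quot_alg1 : \q 1 = 1.
Proof. by []. Qed.
Lemma pi_quot_algM x y : \q (x * y) = \q x * \q y.
Proof. by rewrite -qM. Qed.
Lemma pi_quot_algZ c x : \q (c *: x) = c *: \q x.
Proof. by rewrite -qZ. Qed.

End TwoSidedQuotient.

Section CompanionPolynomial.
Variable C : numFieldType.
Implicit Types P Q F p q : {poly C}.

Local Notation a := (- ('X * ('X - 1)) : {poly C}).
Local Notation b := (- ('X * ('X + 1)) : {poly C}).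

(* [companion_rel Q P] is the identity in C[s] (the variable s is ['X])
   Q(-s(s-1)) - Q(-s(s+1)) = (s-1) P(-s(s-1)) + (s+1) P(-s(s+1)). *)
Definition companion_rel Q P : Prop :=
  (Q \Po (- ('X * ('X - 1)))) - (Q \Po (- ('X * ('X + 1)))) =
  ('X - 1) * (P \Po (- ('X * ('X - 1)))) +
  ('X + 1) * (P \Po (- ('X * ('X + 1)))).

(* The unique P of degree m - 1 attached to Q of degree m; recall that [size] is
   the degree plus one.  See [companionP] and [companion_uniq]. *)
Definition companion Q : {poly C} :=
  xget 0 [set P : {poly C} | size P = (size Q).-1 /\ companion_rel Q P].

Let L P := ('X - 1) * (P \Po a) + ('X + 1) * (P \Po b).

Let LB P Q : L (P - Q) = L P - L Q.
Proof. by rewrite /L !comp_polyB; ring. Qed.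

Let LD P Q : L (P + Q) = L P + L Q.
Proof. by rewrite /L !comp_polyD; ring. Qed.

(* [top p k c]: p has degree at most k, and c is its coefficient of degree k. *)
Let top (p : {poly C}) k c := (size p <= k.+1)%N /\ p`_k = c.

Let topM p q k l c d : top p k c -> top q l d -> top (p * q) (k + l) (c * d).
Proof.
move=> [sp <-] [sq <-]; split.
  by apply: leq_trans (size_polyMleq _ _) _; lia.
rewrite coefM (bigD1 (inord k : 'I_(k + l).+1)) //= inordK ?addKn; last by lia.
rewrite big1 ?addr0 // => j /negP jk.
have /eqP jk' : (j : nat) != k.
  by apply/negP => /eqP jE; apply: jk; apply/eqP/val_inj; rewrite /= inordK //; lia.
have [jk1|jk1] := ltnP k j.
  by rewrite [p`_j]nth_default ?mul0r // (leq_trans sp).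
rewrite [q`_(_ - _)]nth_default ?mulr0 // (leq_trans sq) //.
by move: jk1 jk'; lia.
Qed.

Let topD p q k c d : top p k c -> top q k d -> top (p + q) k (c + d).
Proof.
move=> [sp <-] [sq <-]; split; last by rewrite coefD.
by rewrite (leq_trans (size_polyD _ _)) // geq_max sp.
Qed.

Let topN p k c : top p k c -> top (- p) k (- c).
Proof. by move=> [sp <-]; split; rewrite ?coefN ?size_polyN. Qed.

Let topZ p k c d : top p k c -> top (d *: p) k (d * c).
Proof.
by move=> [sp <-]; split; rewrite ?coefZ // (leq_trans (size_scale_leq _ _)).
Qed.

Let top0 p k : (size p <= k)%N -> top p k 0.
Proof. by move=> sp; split; [apply: leqW | apply: nth_default]. Qed.

Let top_sum n (F : 'I_n -> {poly C}) k (c : 'I_n -> C) :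
  (forall i, top (F i) k (c i)) -> top (\sum_i F i) k (\sum_i c i).
Proof.
by move=> topF; elim/big_ind2: _ => [|????|i _] //;
  [apply: top0; rewrite size_poly0 | apply: topD].
Qed.

Let topX p k c n : top p k c -> top (p ^+ n) (k * n) (c ^+ n).
Proof.
move=> tp; elim: n => [|n IHn]; last by rewrite !exprS mulnS; apply: topM.
by rewrite muln0 !expr0; split; rewrite ?size_poly1 ?coef1.
Qed.

Let top_X : top 'X 1 1.
Proof. by split; rewrite ?size_polyX ?coefX. Qed.

Let top_XD c : top ('X + c%:P) 1 1.
Proof. by split; rewrite ?size_XaddC // coefD coefX coefC addr0. Qed.

Let top_XB1 : top ('X - 1) 1 1.
Proof. by rewrite -polyC1 -polyCN; apply: top_XD. Qed.

Let top_XD1 : top ('X + 1) 1 1.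
Proof. by rewrite -polyC1; apply: top_XD. Qed.

Let top_a : top a 2 (-1).
Proof. by rewrite -[1 in X in top _ _ X]mulr1; apply/topN/(topM (k := 1) (l := 1)). Qed.

Let top_b : top b 2 (-1).
Proof. by rewrite -[1 in X in top _ _ X]mulr1; apply/topN/(topM (k := 1) (l := 1)). Qed.

Let compE P q k : (size P <= k)%N -> P \Po q = \sum_(i < k) P`_i *: q ^+ i.
Proof.
move=> sP; rewrite comp_polyE (big_ord_widen _ (fun i => P`_i *: q ^+ i) sP).
rewrite [RHS](bigID (fun i : 'I_k => (i < size P)%N)) /= [X in _ + X]big1 ?addr0 //.
by move=> i; rewrite -leqNgt => /(nth_default 0) ->; rewrite scale0r.
Qed.

Let top_comp P q k c d : top P k c -> top q 2 d -> top (P \Po q) (2 * k) (c * d ^+ k).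
Proof.
move=> [sP <-] tq; rewrite (compE _ sP) big_ord_recr /= -[X in top _ _ X]add0r.
apply: topD; last exact/topZ/topX.
have -> : 0 = \sum_(i < k) (0 : C) by rewrite big1.
apply: top_sum => i; apply: top0; apply: leq_trans (size_scale_leq _ _) _.
by have [+ _] := topX i tq; have := ltn_ord i; lia.
Qed.

Let top_L P k c : top P k c -> top (L P) (2 * k).+1 (2 * c * (-1) ^+ k).
Proof.
move=> tP; rewrite -mulrA mulr_natl mulr2n -[X in X + _]mul1r -[X in _ + X]mul1r -add1n.
by apply: topD; apply: topM => //; apply: top_comp.
Qed.

Let top_diff Q m c : top Q m.+1 c ->
  top ((Q \Po a) - (Q \Po b)) (2 * m).+1 (c * (2 * (m.+1)%:R * (-1) ^+ m)).
Proof.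
move=> [sQ <-]; rewrite (compE a sQ) (compE b sQ) -sumrB big_ord_recr /= -[X in top _ _ X]add0r.
apply: topD.
  have -> : 0 = \sum_(i < m.+1) (0 : C) by rewrite big1.
  apply: top_sum => i; apply: top0; rewrite -scalerBr.
  apply: leq_trans (size_scale_leq _ _) _.
  have [si _] := topD (topX i top_a) (topN (topX i top_b)).
  by apply: leq_trans si _; rewrite ltnS leq_mul2l -ltnS ltn_ord.
rewrite -scalerBr; apply: topZ; rewrite subrXX.
have -> : a - b = 2 *: 'X by rewrite -mul_polyC polyC_natr; ring.
rewrite -scalerAl -mulrA; apply: topZ.
rewrite -[X in top _ _ X]mul1r -(add1n (2 * m)); apply: topM => //.
have -> : m.+1%:R * (-1) ^+ m = \sum_(i < m.+1) (-1) ^+ m :> C.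
  by rewrite sumr_const card_ord mulr_natl.
apply: top_sum => i /=.
have im : (m = m - i + i)%N by have := ltn_ord i; lia.
by have := topM (topX (m - i) top_a) (topX i top_b); rewrite -mulnDr -exprD -im.
Qed.

Let odd_coef F : F \Po (- 'X) = - F -> forall k, F`_k.*2 = 0.
Proof.
move=> oF k; suff : (F \Po (- 'X))`_k.*2 = F`_k.*2.
  rewrite oF coefN => /eqP; rewrite -subr_eq0 -opprD oppr_eq0 -mulr2n.
  by rewrite mulrn_eq0 => /eqP.
rewrite comp_polyE -[in RHS](coefK F) poly_def !coef_sum; apply: eq_bigr => i _.
rewrite !coefZ exprNn -polyC1 -polyCN -polyC_exp coefCM !coefXn.
by case: eqP => [<-|]; rewrite ?mulr0 // -mul2n exprM sqrrN !expr1n mul1r.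
Qed.

Let comp_aN : a \Po (- 'X) = b.
Proof.
by rewrite raddfN /= comp_polyM comp_polyB comp_polyX -polyC1 comp_polyC; ring.
Qed.

Let comp_bN : b \Po (- 'X) = a.
Proof.
by rewrite raddfN /= comp_polyM comp_polyD comp_polyX -polyC1 comp_polyC; ring.
Qed.

Let L_odd P : L P \Po (- 'X) = - L P.
Proof.
rewrite /L comp_polyD !comp_polyM -!comp_polyA comp_aN comp_bN.
by rewrite comp_polyB comp_polyD comp_polyX -polyC1 comp_polyC; ring.
Qed.

Let diff_odd Q : ((Q \Po a) - (Q \Po b)) \Po (- 'X) = - ((Q \Po a) - (Q \Po b)).
Proof. by rewrite comp_polyB -!comp_polyA comp_aN comp_bN opprB. Qed.

Let L_onto k (F : {poly C}) : F \Po (- 'X) = - F -> (size F <= k.*2)%N ->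
  exists2 P : {poly C}, (size P <= k)%N & L P = F.
Proof.
elim: k F => [|k IHk] F oF sF.
  exists 0; rewrite ?size_poly0 //; move: sF; rewrite leqn0 size_poly_eq0 => /eqP ->.
  by rewrite /L !comp_poly0 !mulr0 addr0.
pose c := F`_k.*2.+1 / (2 * (-1) ^+ k); pose G := F - L (c *: 'X^k).
have cn0 : 2 * (-1) ^+ k != 0 :> C by rewrite mulf_neq0 ?signr_eq0 ?pnatr_eq0.
have oG : G \Po (- 'X) = - G by rewrite comp_polyB oF L_odd opprB opprK addrC.
have tX : top (c *: 'X^k) k c.
  by rewrite -[X in top _ _ X]mulr1; apply: topZ; split; rewrite ?size_polyXn ?coefXn ?eqxx.
have [sG G0] : top G k.*2.+1 0.
  have -> : 0 = F`_k.*2.+1 - 2 * c * (-1) ^+ k.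
    by rewrite /c mulrAC [_ * c]mulrC divfK // subrr.
  by apply: topD; [split | apply: topN; rewrite -mul2n; apply: top_L].
have {}sG : (size G <= k.*2)%N.
  apply/leq_sizeP => j; rewrite leq_eqVlt => /orP[/eqP <-|]; first exact: odd_coef.
  rewrite leq_eqVlt => /orP[/eqP <- //|kj]; apply: nth_default.
  exact: leq_trans sG kj.
have [P sP LP] := IHk G oG sG.
exists (c *: 'X^k + P); last by rewrite LD LP addrC subrK.
rewrite (leq_trans (size_polyD _ _)) // geq_max (leq_trans sP) // andbT.
by have [] := tX.
Qed.

Let size_L P : P != 0 -> size (L P) = (size P).*2.
Proof.
move=> P0; have sP : (0 < size P)%N by rewrite size_poly_gt0.
have [|sL cL] := @top_L P (size P).-1 (lead_coef P).
  by split; rewrite ?prednK.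
apply/eqP; rewrite eqn_leq -[X in (_ <= X.*2)%N](prednK sP); apply/andP; split.
  by move: sL; rewrite mul2n doubleS.
rewrite -(prednK sP) doubleS -mul2n ltnNge; apply/negP => /(nth_default 0).
rewrite cL => /eqP; apply/negP.
by rewrite !mulf_neq0 ?signr_eq0 ?pnatr_eq0 ?lead_coef_eq0.
Qed.

Let L_inj P P' : L P = L P' -> P = P'.
Proof.
move=> LPP; apply/eqP; rewrite -subr_eq0; apply/negP => /negP PP.
have := size_L PP; rewrite LB LPP subrr size_poly0 => /esym/eqP.
by rewrite double_eq0 size_poly_eq0 (negPf PP).
Qed.

Lemma companion_uniq Q P P' : companion_rel Q P -> companion_rel Q P' -> P = P'.
Proof. by move=> QP QP'; apply: L_inj; rewrite /L -QP -QP'. Qed.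

Lemma companionP Q : (1 < size Q)%N ->
  size (companion Q) = (size Q).-1 /\ companion_rel Q (companion Q).
Proof.
move=> sQ; apply: (@xgetPex _ 0 [set P : {poly C} | size P = (size Q).-1 /\ companion_rel Q P]).
have [|sD cD] := @top_diff Q (size Q).-2 (lead_coef Q).
  by split; rewrite ?prednK //; lia.
have D0 : (size ((Q \Po a) - (Q \Po b))) = ((size Q).-1).*2.
  apply/eqP; rewrite eqn_leq; apply/andP; split; first by move: sD; lia.
  suff : ((2 * (size Q).-2).+1 < size ((Q \Po a) - (Q \Po b))%R)%N by lia.
  rewrite ltnNge; apply/negP => /(nth_default 0); rewrite cD => /eqP; apply/negP.
  rewrite !mulf_neq0 ?signr_eq0 ?pnatr_eq0 ?lead_coef_eq0 -?size_poly_gt0 //.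
  exact: leq_trans sQ.
have [P sP LP] := L_onto (diff_odd Q) (eq_leq D0).
exists P; split; last exact/esym.
have P0 : P != 0.
  apply/eqP => P0; move: D0; rewrite -LP P0 /L !comp_poly0 !mulr0 addr0 size_poly0.
  by move: sQ; lia.
by move: D0; rewrite -LP size_L // => /double_inj.
Qed.

End CompanionPolynomial.

Section AlgebraD.
Variable C : numFieldType.

(* The free associative unital algebra C<u, v, w>: the monoid algebra of the
   words on three letters. *)
Definition free_alg : lalgType C := {malg C[{fmonom 'I_3}]}.

Definition gen_u : free_alg := mkmalgU (fmu (0 : 'I_3)) 1.
Definition gen_v : free_alg := mkmalgU (fmu (1 : 'I_3)) 1.
Definition gen_w : free_alg := mkmalgU (fmu (2 : 'I_3)) 1.

Definition eval_u (P : {poly C}) : free_alg := (map_poly (in_alg free_alg) P).[gen_u].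

Local Notation u := gen_u.
Local Notation v := gen_v.
Local Notation w := gen_w.

(* The relators, i.e. left-hand side minus right-hand side of each relation. *)
Inductive relator (Q : {poly C}) (g : C) : free_alg -> Prop :=
| Relator_uv : relator Q g ((u * v - v * u) - 2 * w)
| Relator_uw : relator Q g ((u * w - w * u) - (- 2 * (u * v) + 2 * w + g%:A))
| Relator_vw :
    relator Q g ((v * w - w * v) - (v ^+ 2 + eval_u (companion Q)))
| Relator_Q :
    relator Q g (eval_u Q + u * v ^+ 2 + w ^+ 2 - 2 * (w * v) - g *: v).

Definition algD (Q : {poly C}) (g : C) := quot_alg (relator Q g).

(* [algD Q g] is not an instance of [lalgType], which would require the proof
   that it is nonzero; hence isomorphisms are spelled out. *)
Definition algD_isom (Q : {poly C}) (g : C) (Q' : {poly C}) (g' : C) : Prop :=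
  exists f : algD Q g -> algD Q' g',
    [/\ linear f, monoid_morphism f & bijective f].

Lemma algD_isom_refl Q g : algD_isom Q g Q g.
Proof. by exists id; split => //; exists id. Qed.

Lemma algD_isom_sym Q g Q' g' : algD_isom Q g Q' g' -> algD_isom Q' g' Q g.
Proof.
move=> [f [flin [f1 fM] [h fK hK]]]; exists h; split; last by exists f.
  by move=> c x y; apply: (can_inj fK); rewrite flin !hK.
split=> [|x y]; first by rewrite -[RHS]fK f1.
by rewrite -[RHS]fK (fM (h x) (h y)) !hK.
Qed.

Lemma algD_isom_trans Q g Q' g' Q2 g2 :
  algD_isom Q g Q' g' -> algD_isom Q' g' Q2 g2 -> algD_isom Q g Q2 g2.
Proof.
move=> [f [flin [f1 fM] fbij]] [h [hlin [h1 hM] hbij]].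
exists (h \o f); split; last exact: bij_comp.
  by move=> c x y; rewrite -[LHS]/(h (f _)) (flin c x y) (hlin c (f x) (f y)).
split=> [|x y]; first by rewrite -[LHS]/(h (f _)) f1 h1.
by rewrite -[LHS]/(h (f _)) (fM x y) (hM (f x) (f y)).
Qed.

Variable n : nat.

(* Pairs (Q, gamma) with Q monic of degree n - 1, so that [size Q = n]. *)
Definition param : Type :=
  ({Q : {poly C} | (Q \is monic) && (size Q == n)} * C)%type.

(* The n - 1 non-leading coefficients of Q, followed by gamma. *)
Definition param_coord (x : param) : 'I_n -> C :=
  fun i => if (i < n.-1)%N then (val x.1)`_i else x.2.

Definition param_eq (x y : param) : bool :=
  `[< algD_isom (val x.1) x.2 (val y.1) y.2 >].

Fact param_eq_refl : reflexive param_eq.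
Proof. by move=> x; apply/asboolP/algD_isom_refl. Qed.

Fact param_eq_sym : symmetric param_eq.
Proof.
by move=> x y; apply/asboolP/asboolP => /algD_isom_sym.
Qed.

Fact param_eq_trans : transitive param_eq.
Proof.
by move=> y x z /asboolP xy /asboolP yz; apply/asboolP/(algD_isom_trans xy yz).
Qed.

Canonical param_equiv := EquivRel param_eq param_eq_refl param_eq_sym param_eq_trans.

Definition moduli : Type := {eq_quot param_equiv}.

Definition moduli_class (x : param) : moduli := \pi_({eq_quot param_equiv}) x.

(* Functions on the quotient are the functions on [param] that are constant on
   the classes. *)
Definition moduli_regular (f : moduli -> C) : Prop :=
  exists p : mpoly.mpoly n C,
    forall x : param, f (moduli_class x) = mpoly.meval (param_coord x) p.

Definition polynomial_fun (f : 'rV[C]_n -> C) : Prop :=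
  exists p : mpoly.mpoly n C, forall x, f x = mpoly.meval (fun i => x 0 i) p.

Definition moduli_isom_vector_space : Prop :=
  exists2 phi : moduli -> 'rV[C]_n, bijective phi &
    forall f : 'rV[C]_n -> C, polynomial_fun f <-> moduli_regular (f \o phi).

End AlgebraD.

(* Main.v *)
(* The algebra D(Q, gamma) determines Q, and gamma up to sign, so that the moduli
   space has as coordinates the coefficients of Q and gamma ^ 2.

   Filter D(Q, gamma) by giving u, v, w the weights 2, n - 2, n - 1.  The
   associated graded algebra embeds into C[t, y, 1/y] by u |-> - t ^ 2,
   v |-> t ^ (n - 2) (y + c / y), w |-> t ^ (n - 1) (y - c / y), with the bracket
   {t, y} = - y.  Let u', v', w' be generators of this algebra satisfying the
   relations for another parameter.  As (ad u')^2 v' - 2 (ad u') v' + 4 u' v' is a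
   scalar, the weight of (ad u')^r x is at most r k / 2 up to a constant, for every
   x, where k is the weight of u'.  On the other hand, let t ^ k q(y) be the symbol
   of u'.  If q has a nonzero root, expanding at this root shows that (ad u')^r u
   has weight exactly r (k - 1) + 2; otherwise q is constant, and (ad u')^r v has
   weight r (k - 1) + n - 2.  Hence k <= 2, and n >= 5 forces u' = a u + b.

   The algebra also acts by difference operators on functions on a lattice of step
   one, where u is multiplication by - s (s - 1).  If v' has order J in the shift,
   the relations between leading coefficients give a J ^ 2 = 1, and since
   u', v', w' generate, J = 1 and the leading coefficient of v' is constant.  This
   leads to u' = u and v' = v or v' = - v. *)
From HB Require Import structures.
Require Import Defs.
From mathcomp Require Import all_boot all_order all_algebra.
From mathcomp Require Import generic_quotient boolp reals complex.
From mathcomp Require Import finmap monalg.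
From mathcomp Require Import zify ring.
From mathcomp Require mpoly.

Set Implicit Arguments.
Unset Strict Implicit.
Unset Printing Implicit Defensive.

Import Order.TTheory GRing.Theory Num.Theory.
Local Open Scope ring_scope.
Local Open Scope quotient_scope.

(** * Linear operators on functions on the integers *)

Section Endomorphisms.
Variable C : comNzRingType.

(** Linearity is stated pointwise, so that functions need no module structure of their own;
    composition will be the product. *)
Record endo := Endo {
  endo_fun :> (int -> C) -> int -> C;
  endo_linear : forall a f g m,
    endo_fun (fun i => a * f i + g i) m = a * endo_fun f m + endo_fun g m
}.

HB.instance Definition _ := gen_eqMixin endo.
HB.instance Definition _ := gen_choiceMixin endo.

Lemma endoP (S T : endo) : (forall f m, S f m = T f m) -> S = T.
Proof.
case: S T => [S SL] [T TL] /= ST.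
have {}ST : S = T by apply/funext => f; apply/funext => m; exact: ST.
by subst T; congr Endo; apply: Prop_irrelevance.
Qed.

Program Definition endo0 := @Endo (fun _ _ => 0) _.
Next Obligation. by rewrite mulr0 addr0. Qed.
Program Definition endo1 := @Endo (fun f => f) _.
Program Definition endo_opp (S : endo) := @Endo (fun f m => - S f m) _.
Next Obligation. by rewrite endo_linear opprD mulrN. Qed.
Program Definition endo_add (S T : endo) := @Endo (fun f m => S f m + T f m) _.
Next Obligation. by rewrite !endo_linear mulrDr addrACA. Qed.
Program Definition endo_scale (c : C) (S : endo) := @Endo (fun f m => c * S f m) _.
Next Obligation. by rewrite !endo_linear mulrDr !mulrA [c * a]mulrC. Qed.
Program Definition endo_mul (S T : endo) := @Endo (fun f => S (T f)) _.
Next Obligation.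
rewrite -endo_linear; congr (endo_fun S _ m).
by apply/funext => i; rewrite endo_linear.
Qed.

Fact endo_addA : associative endo_add.
Proof. by move=> S T U; apply: endoP => f m /=; rewrite addrA. Qed.
Fact endo_addC : commutative endo_add.
Proof. by move=> S T; apply: endoP => f m /=; rewrite addrC. Qed.
Fact endo_add0 : left_id endo0 endo_add.
Proof. by move=> S; apply: endoP => f m /=; rewrite add0r. Qed.
Fact endo_addN : left_inverse endo0 endo_opp endo_add.
Proof. by move=> S; apply: endoP => f m /=; rewrite addNr. Qed.

HB.instance Definition _ :=
  GRing.isZmodule.Build endo endo_addA endo_addC endo_add0 endo_addN.

Fact endo_mulA : associative endo_mul.
Proof. by move=> S T U; apply: endoP. Qed.
Fact endo_mul1 : left_id endo1 endo_mul.
Proof. by move=> S; apply: endoP. Qed.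
Fact endo_mulr1 : right_id endo1 endo_mul.
Proof. by move=> S; apply: endoP. Qed.
Fact endo_mulDl : left_distributive endo_mul endo_add.
Proof. by move=> S T U; apply: endoP. Qed.
Fact endo_mulDr : right_distributive endo_mul endo_add.
Proof.
move=> S T U; apply: endoP => f m /=; rewrite -[S (T f) m]mul1r -endo_linear.
by congr (endo_fun S _ m); apply/funext => i; rewrite mul1r.
Qed.
Fact endo_oner_neq0 : endo1 != endo0.
Proof.
apply/eqP => /(congr1 (fun S : endo => S (fun _ => 1) 0)) /= /eqP.
by rewrite oner_eq0.
Qed.

HB.instance Definition _ := GRing.Zmodule_isNzRing.Build endo
  endo_mulA endo_mul1 endo_mulr1 endo_mulDl endo_mulDr endo_oner_neq0.

Fact endo_scaleA a b S : endo_scale a (endo_scale b S) = endo_scale (a * b) S.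
Proof. by apply: endoP => f m /=; rewrite mulrA. Qed.
Fact endo_scale1 : left_id 1 endo_scale.
Proof. by move=> S; apply: endoP => f m /=; rewrite mul1r. Qed.
Fact endo_scaleDr : right_distributive endo_scale +%R.
Proof. by move=> a S T; apply: endoP => f m /=; rewrite mulrDr. Qed.
Fact endo_scaleDl S : {morph endo_scale^~ S : a b / a + b}.
Proof. by move=> a b; apply: endoP => f m /=; rewrite mulrDl. Qed.

HB.instance Definition _ := GRing.Zmodule_isLmodule.Build C endo
  endo_scaleA endo_scale1 endo_scaleDr endo_scaleDl.

Fact endo_scaleAl (a : C) (S T : endo) : a *: (S * T) = a *: S * T.
Proof. exact: endoP. Qed.
HB.instance Definition _ := GRing.Lmodule_isLalgebra.Build C endo endo_scaleAl.

Fact endo_scaleAr (a : C) (S T : endo) : a *: (S * T) = S * (a *: T).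
Proof.
apply: endoP => f m /=; have := endo_linear S a (T f) (fun _ => 0) m.
have -> : S (fun _ => 0) m = 0.
  have {1}-> : (fun _ : int => 0 : C) = (fun _ => -1 * 0 + 0).
    by apply/funext => i; rewrite mulr0 addr0.
  by rewrite endo_linear mulN1r addNr.
rewrite addr0 => <-; congr (endo_fun S _ m).
by apply/funext => i; rewrite addr0.
Qed.
HB.instance Definition _ := GRing.Lalgebra_isAlgebra.Build C endo endo_scaleAr.

Lemma endoD (S T : endo) f m : (S + T) f m = S f m + T f m. Proof. by []. Qed.
Lemma endoN (S : endo) f m : (- S) f m = - S f m. Proof. by []. Qed.
Lemma endoM (S T : endo) f m : (S * T) f m = S (T f) m. Proof. by []. Qed.
Lemma endoZ a (S : endo) f m : (a *: S) f m = a * S f m. Proof. by []. Qed.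
Lemma endo1E f m : (1 : endo) f m = f m. Proof. by []. Qed.

End Endomorphisms.

(** * Symbols of elements *)

Lemma horner_alg_sum (K : comNzRingType) (E : algType K) (u : E) (f : {poly K}) d :
  (size f <= d)%N -> horner_alg u f = \sum_(i < d) f`_i *: u ^+ i.
Proof.
move=> sf; have {1}-> : f = \poly_(i < d) f`_i.
  apply/polyP => i; rewrite coef_poly; case: ltnP => // di.
  by rewrite nth_default // (leq_trans sf).
rewrite poly_def linear_sum; apply: eq_bigr => i _.
by rewrite linearZ rmorphXn /= horner_algX -scalerAl mul1r.
Qed.

(** * The defining relations as rewriting rules *)

Section Presentation.
Variables (K : comNzRingType) (E : algType K).

(** The relations are solved for [v * u], [w * u], [w * v] and [w * w], so that they rewrite
    products towards the ordered monomials u^i v^j w^e with e at most 1. [P] stays free; the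
    companion of [Q] is put in for it later. *)
Record relations (Q P : {poly K}) (g : K) (u v w : E) : Prop := Relations {
  rel_vu : v * u = u * v - w *+ 2;
  rel_wu : w * u = u * w + (u * v) *+ 2 - w *+ 2 - g%:A;
  rel_wv : w * v = v * w - v * v - horner_alg u P;
  rel_ww : w * w = (w * v) *+ 2 + g *: v - horner_alg u Q - u * (v * v)
}.

Inductive gen3 (u v w : E) : E -> Prop :=
| gen3_1 : gen3 u v w 1
| gen3_u x of gen3 u v w x : gen3 u v w (u * x)
| gen3_v x of gen3 u v w x : gen3 u v w (v * x)
| gen3_w x of gen3 u v w x : gen3 u v w (w * x)
| gen3_lin a x y of gen3 u v w x & gen3 u v w y : gen3 u v w (a *: x + y).

Lemma gen3_comm (u v w z x : E) :
  GRing.comm z u -> GRing.comm z v -> GRing.comm z w -> gen3 u v w x -> GRing.comm z x.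
Proof.
move=> zu zv zw; elim=> [|y _ zy|y _ zy|y _ zy|a y y' _ zy _ zy'].
- exact: commr1.
- exact: commrM.
- exact: commrM.
- exact: commrM.
- by apply: commrD => //; rewrite /GRing.comm -scalerAr -scalerAl zy.
Qed.

End Presentation.

Section Symbols.
Variables (K : numClosedFieldType) (E : algType K) (N : nat) (c : K).
Hypothesis N3 : (3 <= N)%N.
Hypothesis c4 : 4 * c = (-1) ^+ N.+1.
Variables (Q P : {poly K}) (g : K) (U V W : E).
Hypothesis UVW : relations Q P g U V W.
Hypothesis Qmonic : Q \is monic.
Hypothesis sQ : size Q = N.+2.
Hypothesis sP : (size P <= N.+1)%N.

(* A homogeneous element t ^ k q(y) of the associated graded algebra, seen in
   C[t, y, 1/y], is encoded by the polynomial y ^ k q(y): no negative power of y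
   remains, products are kept, and the bracket of weights k and l becomes
   l q p' - k p q'. *)
Definition symX : {poly K} := - 'X ^+ 2.
Definition symY : {poly K} := 'X ^+ N.-1 * ('X ^+ 2 + c%:P).
Definition symZ : {poly K} := 'X ^+ N * ('X ^+ 2 - c%:P).

Local Notation X := symX.
Local Notation Y := symY.
Local Notation Z := symZ.

(** This is the top-weight part of the relation for w^2. Since (y^2 - c)^2 - (y^2 + c)^2 = - 4 c
    y^2, it forces the value of [c]. *)
Lemma symZZ : Z * Z = - X ^+ N.+1 - X * Y ^+ 2.
Proof.
have XN : 'X ^+ N = 'X * 'X ^+ N.-1 :> {poly K} by rewrite -exprS prednK //; lia.
have -> : X ^+ N.+1 = (4 * c)%:P * ('X ^+ N * 'X) ^+ 2.
  by rewrite c4 rmorphXn rmorphN1 -exprSr -exprM mulnC exprM -exprNn.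
by rewrite /X /Y /Z XN polyCM; ring.
Qed.


Definition wt (i j e : nat) := (2 * i + N * j + N.+1 * e)%N.

(* [sym k x p]: the element [x] has weight at most [k], and [p] is its symbol in
   weight [k] (zero if [x] has a smaller weight). *)
Inductive sym : nat -> E -> {poly K} -> Prop :=
| sym_pbw i j (e : bool) : sym (wt i j e) (U ^+ i * V ^+ j * W ^+ e) (X ^+ i * Y ^+ j * Z ^+ e)
| sym_lin a k x p y q of sym k x p & sym k y q : sym k (a *: x + y) (a *: p + q)
| sym_up k x p of sym k x p : sym k.+1 x 0.

Lemma sym_eq k x p k' x' p' : sym k x p -> k = k' -> x = x' -> p = p' -> sym k' x' p'.
Proof. by move=> s <- <- <-. Qed.

Lemma sym_1 : sym 0 1 1.
Proof. by apply: sym_eq (sym_pbw 0 0 false) _ _ _; rewrite ?expr0 ?mulr1 //= /wt !muln0. Qed.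

Lemma sym_0 k : sym k 0 0.
Proof.
elim: k => [|k IHk]; last exact: sym_up IHk.
by apply: sym_eq (sym_lin (-1) sym_1 sym_1) _ _ _; rewrite // scaleN1r addNr.
Qed.

Lemma symD k x p y q : sym k x p -> sym k y q -> sym k (x + y) (p + q).
Proof. by move=> sx sy; have := sym_lin 1 sx sy; rewrite !scale1r. Qed.

Lemma sym_scale a k x p : sym k x p -> sym k (a *: x) (a *: p).
Proof. by move=> sx; have := sym_lin a sx (sym_0 k); rewrite !addr0. Qed.

Lemma symN k x p : sym k x p -> sym k (- x) (- p).
Proof. by move=> /(sym_scale (-1)); rewrite !scaleN1r. Qed.

Lemma symB k x p y q : sym k x p -> sym k y q -> sym k (x - y) (p - q).
Proof. by move=> sx sy; apply/symD/symN. Qed.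

Lemma symMn k x p m : sym k x p -> sym k (x *+ m) (p *+ m).
Proof. by move=> /(sym_scale m%:R); rewrite !scaler_nat. Qed.

Lemma sym_lt k l x p : sym k x p -> (k < l)%N -> sym l x 0.
Proof.
move=> sx; elim: l => // l IHl; rewrite ltnS leq_eqVlt => /predU1P[<-|kl].
  exact: sym_up sx.
exact: sym_up (IHl kl).
Qed.

Let VU b : V * (U * b) = U * (V * b) - (W * b) *+ 2.
Proof. by rewrite mulrA (rel_vu UVW) mulrBl mulrnAl !mulrA. Qed.

Let WU b : W * (U * b) = U * (W * b) + (U * (V * b)) *+ 2 - (W * b) *+ 2 - g *: b.
Proof.
rewrite mulrA (rel_wu UVW) 2!mulrBl mulrDl !mulrnAl -scalerAl mul1r.
by rewrite !mulrA.
Qed.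

Let WV b : W * (V * b) = V * (W * b) - V * (V * b) - horner_alg U P * b.
Proof. by rewrite mulrA (rel_wv UVW) !mulrBl !mulrA. Qed.

Lemma sym_lmulU k x p : sym k x p -> sym (k + 2) (U * x) (X * p).
Proof.
elim=> {k x p} [i j e|a k x p y q _ sx _ sy|k x p _ sx].
- apply: sym_eq (sym_pbw i.+1 j e) _ _ _; rewrite /wt ?exprS ?mulrA //.
  by rewrite mulnS -!addnA addnC -!addnA.
- by rewrite !mulrDr -!scalerAr; apply: sym_lin.
- by rewrite mulr0 addSn; apply: sym_up sx.
Qed.

Lemma sym_lmulUX i k x p : sym k x p -> sym (2 * i + k) (U ^+ i * x) (X ^+ i * p).
Proof.
move=> sx; elim: i => [|i IHi]; first by rewrite !mul1r.
by rewrite !exprS -!mulrA; apply: sym_eq (sym_lmulU IHi) _ _ _ => //; lia.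
Qed.

Lemma sym_lmul_poly (f : {poly K}) d k x p : (size f <= d.+1)%N -> sym k x p ->
  sym (2 * d + k) (horner_alg U f * x) (f`_d *: X ^+ d * p).
Proof.
move=> sf sx; rewrite (horner_alg_sum _ sf) big_ord_recr /= mulrDl -[_ * p]add0r.
rewrite -!scalerAl; apply: symD; last exact/sym_scale/sym_lmulUX.
rewrite mulr_suml; elim/big_ind: _ => [|y z sy sz|i _]; first exact: sym_0.
  by rewrite -[0]addr0; apply: symD.
rewrite -scalerAl -[X in sym _ _ X](scaler0 _ f`_i); apply: sym_scale.
by apply: sym_lt (sym_lmulUX i sx) _; rewrite ltn_add2r ltn_pmul2l.
Qed.

Let PV l := forall x q, sym l x q -> sym (l + N) (V * x) (Y * q).
Let PW l := forall x q, sym l x q -> sym (l + N.+1) (W * x) (Z * q).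

(** In V U b = U V b - 2 W b, the weight of b is smaller by 2 and W adds only one more than V, so
    the last term falls below the weight in question and leaves no symbol. *)
Let stepV l : (forall i, (i.+2 <= l)%N -> PV i /\ PW i) -> PV l.
Proof.
move=> IH x q sx; elim: sx IH => {l x q} [[|i] j e|a k x p y q _ sx _ sy|k x p _ sx] IH.
- apply: sym_eq (sym_pbw 0 j.+1 e) _ _ _; rewrite /wt ?expr0 ?mul1r ?exprS ?mulrA //.
  by lia.
- have [|PVk PWk] := IH (wt i j e); first by rewrite /wt; lia.
  have sV := sym_lmulU (PVk _ _ (sym_pbw i j e)).
  have sW : sym (wt i j e + N + 2) (W * (U ^+ i * V ^+ j * W ^+ e)) 0.
    by apply: sym_lt (PWk _ _ (sym_pbw i j e)) _; lia.
  apply: sym_eq (symB sV (symMn 2 sW)) _ _ _; first by rewrite /wt; lia.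
    by rewrite exprS -!mulrA VU !mulrA.
  by rewrite mul0rn subr0 !exprS; ring.
- by rewrite !mulrDr -!scalerAr; apply: sym_lin; [apply: sx|apply: sy].
- rewrite mulr0 addSn; apply: sym_up (sx _) => i ik.
  by apply: IH; apply: leqW.
Qed.

(** In W V b = V W b - V V b - P(U) b, the element W b weighs one more than V b, so [PV] is needed
    up to [l.+1]. Only the first term counts for the symbol. *)
Let stepW l : (forall i, (i.+2 <= l)%N -> PV i /\ PW i) ->
  (forall i, (i <= l.+1)%N -> PV i) -> PW l.
Proof.
move=> IH IHV x q sx; elim: sx IH IHV => {l x q} [i j e|a k x p y q _ sx _ sy|k x p _ sx] IH IHV.
- case: i IH IHV => [|i] IH IHV; last first.
    have [|PVk PWk] := IH (wt i j e); first by rewrite /wt; lia.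
    have s0 := sym_pbw i j e; have sV := sym_lmulU (PVk _ _ s0).
    have sUW := sym_lmulU (PWk _ _ s0).
    have wE : (wt i j e + N.+1 + 2 = wt i.+1 j e + N.+1)%N by rewrite /wt; lia.
    rewrite wE in sUW.
    have {}sV : sym (wt i.+1 j e + N.+1) (U * (V * (U ^+ i * V ^+ j * W ^+ e))) 0.
      by apply: sym_lt sV _; rewrite /wt; lia.
    have sW : sym (wt i.+1 j e + N.+1) (W * (U ^+ i * V ^+ j * W ^+ e)) 0.
      by apply: sym_lt (PWk _ _ s0) _; rewrite /wt; lia.
    have {}s0 : sym (wt i.+1 j e + N.+1) (U ^+ i * V ^+ j * W ^+ e) 0.
      by apply: sym_lt s0 _; rewrite /wt; lia.
    apply: sym_eq (symB (symB (symD sUW (symMn 2 sV)) (symMn 2 sW)) (sym_scale g s0)) _ _ _ => //.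
      by rewrite exprS -!mulrA WU !mulrA.
    by rewrite mul0rn scaler0 !subr0 addr0 !exprS; ring.
  case: j IH IHV => [|j] IH IHV; last first.
    have [|PVk PWk] := IH (wt 0 j e); first by rewrite /wt; lia.
    have s0 := sym_pbw 0 j e.
    have sV : sym (wt 0 j.+1 e) (V * (U ^+ 0 * V ^+ j * W ^+ e)) (Y * (X ^+ 0 * Y ^+ j * Z ^+ e)).
      by apply: sym_eq (PVk _ _ s0) _ _ _ => //; rewrite /wt; lia.
    have sVV : sym (wt 0 j.+1 e + N.+1) (V * (V * (U ^+ 0 * V ^+ j * W ^+ e))) 0.
      by apply: sym_lt (IHV _ _ _ _ sV) _; lia.
    have sVW : sym (wt 0 j.+1 e + N.+1) (V * (W * (U ^+ 0 * V ^+ j * W ^+ e)))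
        (Y * (Z * (X ^+ 0 * Y ^+ j * Z ^+ e))).
      by apply: sym_eq (IHV _ _ _ _ (PWk _ _ s0)) _ _ _ => //; rewrite /wt; lia.
    have sPb : sym (wt 0 j.+1 e + N.+1) (horner_alg U P * (U ^+ 0 * V ^+ j * W ^+ e)) 0.
      by apply: sym_lt (sym_lmul_poly sP s0) _; rewrite /wt; lia.
    apply: sym_eq (symB (symB sVW sVV) sPb) _ _ _ => //.
      by rewrite !expr0 !mul1r exprS -!mulrA WV !mulrA.
    by rewrite !subr0 !exprS; ring.
  (* The monomial is now 1 or [W]. For [W], the relation for W^2 leaves - U^(N+1) - U V^2 in weight
     2 N + 2, whose symbol is Z^2 by [symZZ]. *)
  case: e IH IHV => IH IHV; last first.
    by apply: sym_eq (sym_pbw 0 0 true) _ _ _; rewrite /wt ?expr0 ?expr1 ?mulr1 ?mul1r //; lia.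
  have sQU := sym_lmul_poly (eq_leq sQ) sym_1.
  have wE : (2 * N.+1 + 0 = wt 0 0 true + N.+1)%N by rewrite /wt; lia.
  rewrite wE mulr1 in sQU.
  have Q1 : Q`_N.+1 = 1 by move/monicP: Qmonic; rewrite lead_coefE sQ.
  have sUVV : sym (wt 0 0 true + N.+1) (U * (V * V)) (X * Y ^+ 2).
    by apply: sym_eq (sym_pbw 1 2 false) _ _ _;
      rewrite /wt ?expr1 ?mulr1 ?expr0 ?expr2 ?mulr1 //; lia.
  have sVW : sym (wt 0 0 true + N.+1) (V * W) 0.
    by rewrite -[V * W]mulr1; apply: sym_lt (sym_eq (sym_pbw 0 1 true) erefl _ erefl) _;
      rewrite ?expr0 ?mul1r ?mulr1 //= /wt; lia.
  have sVV : sym (wt 0 0 true + N.+1) (V * V) 0.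
    by apply: sym_lt (sym_eq (sym_pbw 0 2 false) erefl _ erefl) _;
      rewrite ?expr0 ?mul1r ?mulr1 ?expr2 //= /wt; lia.
  have sV : sym (wt 0 0 true + N.+1) V 0.
    by apply: sym_lt (sym_eq (sym_pbw 0 1 false) erefl _ erefl) _;
      rewrite ?expr0 ?mul1r ?mulr1 ?expr1 //= /wt; lia.
  have sPU : sym (wt 0 0 true + N.+1) (horner_alg U P) 0.
    by rewrite -[horner_alg U P]mulr1; apply: sym_lt (sym_lmul_poly sP sym_1) _; rewrite /wt; lia.
  have sWV := symMn 2 (symB (symB sVW sVV) sPU).
  apply: sym_eq (symB (symB (symD sWV (sym_scale g sV)) sQU) sUVV) _ _ _ => //.
      by rewrite /= ?expr0 ?mul1r ?mulr1 ?expr1 (rel_ww UVW) (rel_wv UVW).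
  by rewrite /= !subr0 mul0rn scaler0 addr0 sub0r Q1 scale1r ?expr0 ?mul1r ?mulr1 ?expr1 symZZ.
- by rewrite !mulrDr -!scalerAr; apply: sym_lin; [apply: sx|apply: sy].
- rewrite mulr0 addSn; apply: sym_up (sx _ _) => i ik.
    by apply: IH; apply: leqW.
  by apply: IHV; apply: leqW.
Qed.

Let symVW l : (forall i, (i <= l.+1)%N -> PV i) /\ (forall i, (i <= l)%N -> PW i).
Proof.
elim: l => [|l [IHV IHW]].
  have PV1 i : (i <= 1)%N -> PV i by move=> i1; apply: stepV => j; lia.
  by split=> // i i0; apply: stepW => j ij; [lia | apply: PV1; lia].
have PVl i : (i <= l.+2)%N -> PV i.
  by move=> il; apply: stepV => j ji; split; [apply: IHV | apply: IHW]; lia.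
split=> // i il; apply: stepW => j ji; last by apply: PVl; lia.
by split; [apply: IHV | apply: IHW]; lia.
Qed.

Lemma sym_lmulV k x p : sym k x p -> sym (k + N) (V * x) (Y * p).
Proof. by have [+ _] := symVW k => /(_ k); apply. Qed.

Lemma sym_lmulW k x p : sym k x p -> sym (k + N.+1) (W * x) (Z * p).
Proof. by have [_ +] := symVW k => /(_ k); apply. Qed.

Lemma symM k x p l y q : sym k x p -> sym l y q -> sym (k + l) (x * y) (p * q).
Proof.
move=> sx sy; elim: sx => {k x p} [i j e|a k x p x' p' _ sx _ sx'|k x p _ sx].
- have sW : sym (N.+1 * e + l) (W ^+ e * y) (Z ^+ e * q).
    case: e; last by rewrite muln0 !expr0 !mul1r.
    by rewrite muln1 !expr1 addnC; apply: sym_lmulW.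
  have sV : sym (N * j + (N.+1 * e + l)) (V ^+ j * (W ^+ e * y)) (Y ^+ j * (Z ^+ e * q)).
    elim: j => [|j IHj]; first by rewrite muln0 !expr0 !mul1r.
    by rewrite !exprS -(mulrA V) -(mulrA Y); apply: sym_eq (sym_lmulV IHj) _ _ _ => //; lia.
  apply: sym_eq (sym_lmulUX i sV) _ _ _; [|by rewrite !mulrA|by rewrite !mulrA].
  by rewrite /wt !addnA.
- by rewrite !mulrDl -!scalerAl; apply: sym_lin.
- by rewrite mul0r addSn; apply: sym_up sx.
Qed.

Lemma sym_U : sym 2 U X.
Proof. by have := sym_lmulU sym_1; rewrite !mulr1. Qed.
Lemma sym_V : sym N V Y.
Proof. by have := sym_lmulV sym_1; rewrite !mulr1. Qed.
Lemma sym_W : sym N.+1 W Z.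
Proof. by have := sym_lmulW sym_1; rewrite !mulr1. Qed.

Lemma gen3_sym x : gen3 U V W x -> exists k p, sym k x p.
Proof.
elim=> {x} [|x _ [k [p sx]]|x _ [k [p sx]]|x _ [k [p sx]]|a x y _ [k [p sx]] _ [l [q sy]]].
- by exists 0, 1; apply: sym_1.
- by exists (k + 2)%N, (X * p); apply: sym_lmulU.
- by exists (k + N)%N, (Y * p); apply: sym_lmulV.
- by exists (k + N.+1)%N, (Z * p); apply: sym_lmulW.
(* The two weights may differ: both terms are raised strictly above their weights, where their
   symbols are zero. *)
- exists (k + l).+1, (a *: 0 + 0); apply: sym_lin.
    by apply: sym_lt sx _; lia.
  by apply: sym_lt sy _; lia.
Qed.


(** * Ordered monomials and the shape of a leading symbol *)

Definition pbw M (t : 'I_M * 'I_M * bool) : E := U ^+ t.1.1 * V ^+ t.1.2 * W ^+ t.2.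
Definition symbol M (t : 'I_M * 'I_M * bool) := X ^+ t.1.1 * Y ^+ t.1.2 * Z ^+ t.2.
Definition weight M (t : 'I_M * 'I_M * bool) := wt t.1.1 t.1.2 t.2.
Definition level M (t : 'I_M * 'I_M * bool) := (t.1.2 + t.2)%N.

(** Every exponent of a monomial is at most its weight, so all monomials involved fit in the index
    set as soon as [k < M]. *)
Lemma sym_coef M k x p : sym k x p -> (k < M)%N ->
  exists a : 'I_M * 'I_M * bool -> K,
  [/\ forall t, (k < weight t)%N -> a t = 0, x = \sum_t a t *: pbw t
    & p = \sum_(t | weight t == k) a t *: symbol t].
Proof.
elim=> {k x p} [i j e|a k x p y q _ IHx _ IHy|k x p _ IHx] kM.
- have iM : (i < M)%N by apply: leq_ltn_trans kM; rewrite /wt; lia.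
  have jM : (j < M)%N.
    by apply: leq_ltn_trans kM; have := leq_pmull j (ltnW (ltnW N3)); rewrite /wt; lia.
  pose t0 := (Ordinal iM, Ordinal jM, e).
  exists (fun t => (t == t0)%:R); split=> [t||].
  + by case: eqP => // ->; rewrite ltnn.
  + rewrite (bigD1 t0) //= eqxx scale1r big1 ?addr0 // => t /negPf ->.
    by rewrite scale0r.
  + rewrite (bigD1 t0) //= eqxx scale1r big1 ?addr0 // => t /andP[_ /negPf ->].
    by rewrite scale0r.
- have [b [b0 -> ->]] := IHx kM; have [d [d0 -> ->]] := IHy kM.
  exists (fun t => a * b t + d t); split=> [t kt||].
  + by rewrite b0 // d0 // mulr0 addr0.
  + rewrite scaler_sumr -big_split; apply: eq_bigr => t _ /=.
    by rewrite scalerDl scalerA.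
  + rewrite scaler_sumr -big_split; apply: eq_bigr => t _ /=.
    by rewrite scalerDl scalerA.
- have [b [b0 -> _]] := IHx (ltnW kM); exists b; split=> // [t kt|].
    by apply: b0; apply: ltnW.
  by rewrite big1 // => t /eqP tk; rewrite b0 ?scale0r // tk.
Qed.

Lemma sym_sum M k (a : 'I_M * 'I_M * bool -> K) :
  (forall t, a t != 0 -> (weight t <= k)%N) ->
  sym k (\sum_t a t *: pbw t) (\sum_(t | weight t == k) a t *: symbol t).
Proof.
move=> ak; rewrite [X in sym _ _ X]big_mkcond /=.
elim/big_ind2: _ => [|x p y q sx sy|t _]; [exact: sym_0 | exact: symD |].
case: eqP => [<-|/eqP tk]; first exact/sym_scale/sym_pbw.
have [->|/ak] := eqVneq (a t) 0; first by rewrite scale0r; apply: sym_0.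
rewrite leq_eqVlt (negPf tk) /= => /sym_lt tlk.
by rewrite -[X in sym _ _ X](scaler0 _ (a t)); apply/sym_scale/tlk/sym_pbw.
Qed.

Let c_neq0 : c != 0.
Proof.
apply/eqP => c0; move: c4; rewrite c0 mulr0 => /esym/eqP.
by rewrite signr_eq0.
Qed.

Definition symbol_core (j e : nat) := ('X ^+ 2 + c%:P) ^+ j * ('X ^+ 2 - c%:P) ^+ e.

Let size_XnDC (a : K) : size ('X ^+ 2 + a%:P) = 3%N.
Proof. by rewrite size_XnaddC. Qed.

Let monic_XnDC (a : K) : 'X ^+ 2 + a%:P \is monic.
Proof. by rewrite qualifE /= lead_coefE size_XnDC coefD coefXn coefC addr0. Qed.

Lemma size_symbol_core j e : size (symbol_core j e) = (2 * (j + e)).+1.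
Proof.
have sX a i : size (('X ^+ 2 + a%:P : {poly K}) ^+ i) = (2 * i).+1.
  rewrite -[LHS]prednK ?size_exp ?size_XnDC // size_poly_gt0.
  by rewrite monic_neq0 // monic_exp // monic_XnDC.
rewrite /symbol_core -polyCN size_monicM ?monic_exp ?sX ?monic_neq0 ?monic_exp //.
by lia.
Qed.

Lemma symbol_core0 j e : (symbol_core j e)`_0 != 0.
Proof.
rewrite -horner_coef0 /symbol_core hornerM !horner_exp !hornerE /= expr0n /=.
by rewrite add0r sub0r mulf_neq0 // expf_neq0 // oppr_eq0.
Qed.

(** A symbol is divisible by y exactly weight - level times. For levels up to [J] the power
    [weight t - J] is thus a common factor, and a level below [J] leaves a further power of y. *)
Lemma symbolE M (t : 'I_M * 'I_M * bool) J : (level t <= J)%N -> (J <= weight t)%N ->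
  symbol t = 'X ^+ (weight t - J) *
    ((-1) ^+ t.1.1 *: ('X ^+ (J - level t) * symbol_core t.1.2 t.2)).
Proof.
case: t => [[i j] e]; rewrite /symbol /weight /level /wt /= => eJ Jt.
have Nj : (N * j = N.-1 * j + j)%N by rewrite -mulSnr prednK //; lia.
have -> : X ^+ i = (-1) ^+ i *: 'X ^+ (2 * i).
  by rewrite /symX (exprNn ('X ^+ 2)) -(exprM 'X) -mul_polyC rmorphXn rmorphN1.
rewrite /Y /Z /symbol_core [in LHS]exprMn [in X in _ * X]exprMn -!exprM.
rewrite -!scalerAl -!scalerAr; congr (_ *: _).
have -> : ('X ^+ (2 * i + N * j + N.+1 * e - J) * ('X ^+ (J - (j + e)) *
    (('X ^+ 2 + c%:P) ^+ j * ('X ^+ 2 - c%:P) ^+ e))) =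
   'X ^+ (2 * i + N.-1 * j + N * e) * (('X ^+ 2 + c%:P) ^+ j * ('X ^+ 2 - c%:P) ^+ e).
  by rewrite mulrA -exprD; congr ('X ^+ _ * _); lia.
by rewrite !exprD; ring.
Qed.

(** The number weight - N * level is 2 i + e, and its parity gives e. *)
Lemma weight_level_inj M (t t' : 'I_M * 'I_M * bool) :
  weight t = weight t' -> level t = level t' -> t = t'.
Proof.
case: t t' => [[i j] e] [[i' j'] e']; rewrite /weight /level /wt /= => tw tl.
have ee : e = e'.
  case: e e' tw tl => [] [] //= tw tl; exfalso.
    have jE : (j' : nat) = j.+1 by lia.
    by move: tw; rewrite jE mulnS; lia.
  have jE : (j : nat) = j'.+1 by lia.
  by move: tw; rewrite jE mulnS; lia.
subst e'; have jj : j = j' by apply/val_inj => /=; lia.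
subst j'; have -> : i = i' by apply/val_inj => /=; lia.
by [].
Qed.

(** [J] is the largest level with a nonzero coefficient in weight [k]. One monomial only reaches it,
    and it alone contributes to the coefficients of [r] in degrees 0 and 2 J: a term of level l < J
    is divisible by y^(J - l) and has degree J + l. *)
Lemma symbol_sumE M k (a : 'I_M * 'I_M * bool -> K) t1 :
  weight t1 = k -> a t1 != 0 ->
  exists J (r : {poly K}), [/\ (N * J <= k)%N, r`_0 != 0, size r = (2 * J).+1
    & \sum_(t | weight t == k) a t *: symbol t = 'X ^+ (k - J) * r].
Proof.
move=> /eqP t1k a1; pose S t := (weight t == k) && (a t != 0).
have [t0 /andP[/eqP t0k a0] t0max] :=
  @arg_maxnP _ t1 S (fun t => level t) (introT andP (conj t1k a1)).
have {}t0max t : S t -> (level t <= level t0)%N := t0max t.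
pose J := level t0.
have NJ : (N * J <= k)%N.
  by rewrite -t0k /J /weight /level /wt mulnDr; lia.
have Jk : (J <= k)%N by have := leq_pmull J (ltnW (ltnW N3)); lia.
pose F t := a t *: ((-1) ^+ t.1.1 *: ('X ^+ (J - level t) * symbol_core t.1.2 t.2)).
pose B := \sum_(t | (weight t == k) && (t != t0)) F t.
have Flt t : (weight t == k) && (t != t0) -> (F t)`_0 = 0 /\ (size (F t) <= 2 * J)%N.
  move=> /andP[/eqP tk tt0]; have [at0|at0] := eqVneq (a t) 0.
    by rewrite /F at0 scale0r coef0 size_poly0.
  have tJ : (level t < J)%N.
    rewrite ltn_neqAle t0max ?andbT; last by rewrite /S tk eqxx at0.
    by apply: contra tt0 => /eqP tJ; apply/eqP/weight_level_inj; rewrite ?tk.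
  split.
    rewrite /F !coefZ -(prednK (n := (J - level t)%N)) ?subn_gt0 // exprS -mulrA coefXM.
    by rewrite eqxx !mulr0.
  rewrite /F (leq_trans (size_scale_leq _ _)) // (leq_trans (size_scale_leq _ _)) //.
  rewrite (leq_trans (size_polyMleq _ _)) // size_polyXn size_symbol_core.
  by move: tJ; rewrite /level; lia.
have B0 : B`_0 = 0 by rewrite /B coef_sum big1 // => t /Flt[].
have sB : (size B <= 2 * J)%N.
  by apply: (leq_trans (size_sum _ _ _)); apply/bigmax_leqP => t /Flt[].
have F0 : F t0 = (a t0 * (-1) ^+ t0.1.1) *: symbol_core t0.1.2 t0.2.
  by rewrite /F subnn mul1r scalerA.
have s0 : a t0 * (-1) ^+ t0.1.1 != 0 by rewrite mulf_neq0 // signr_eq0.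
exists J, (F t0 + B); split=> //.
- by rewrite coefD B0 addr0 F0 coefZ mulf_neq0 // symbol_core0.
- by rewrite size_polyDl F0 size_scale // size_symbol_core // ltnS.
rewrite (bigD1 t0) ?t0k //= mulrDr /B mulr_sumr; congr (_ + _).
  by rewrite /F -scalerAr; congr (_ *: _); rewrite (@symbolE _ _ J) ?t0k.
apply: eq_bigr => t /andP[/eqP tk _].
have [at0|at0] := eqVneq (a t) 0; first by rewrite /F at0 !scale0r mulr0.
rewrite /F -scalerAr; congr (_ *: _); rewrite (@symbolE _ _ J) ?tk //.
by apply: t0max; rewrite /S tk eqxx at0.
Qed.

(** For a leading term t^k q(y), either q is constant or q has a nonzero root. The bound [m <= k]
    keeps a factor 2 m + r (k - m) positive in [ad_growth]. *)
Definition mono_or_root k (p : {poly K}) :=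
  (exists2 a, a != 0 & p = a *: 'X ^+ k) \/
  (exists al m (q : {poly K}),
    [/\ al != 0, (0 < m <= k)%N, p = q * ('X - al%:P) ^+ m & q.[al] != 0]).

Lemma mono_or_rootP k J (r : {poly K}) : (N * J <= k)%N -> r`_0 != 0 -> size r = (2 * J).+1 ->
  mono_or_root k ('X ^+ (k - J) * r).
Proof.
case: J => [|J] NJ r0 sr.
  left; exists r`_0 => //; have -> : r = (r`_0)%:P by apply: size1_polyC; rewrite sr.
  by rewrite coefC /= subn0 mulrC mul_polyC.
right; have rN0 : r != 0 by rewrite -size_poly_gt0 sr.
have /closed_rootP[al ral] : size r != 1 by rewrite sr; lia.
have al0 : al != 0.
  by apply: contraNneq r0 => al0; move: ral; rewrite al0 rootE horner_coef0.
have [m [q]] := multiplicity_XsubC r al; rewrite rN0 /= => qal rE.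
have m0 : (0 < m)%N.
  by case: m rE => // rE; move: ral; rewrite rE expr0 mulr1 (negPf qal).
have qN0 : q != 0 by apply: contraNneq qal => ->; rewrite root0.
(* The multiplicity is at most the degree of [r], hence at most [N * J.+1], which is at most [k]. *)
have mJ : (m <= 2 * J.+1)%N.
  have : size r = (size q + m)%N.
    by rewrite rE size_Mmonic ?monic_exp ?monicXsubC // size_exp_XsubC addnS.
  by rewrite sr; have := size_poly_gt0 q; rewrite qN0; lia.
exists al, m, ('X ^+ (k - J.+1) * q); split=> //.
- by rewrite m0 (leq_trans mJ) // (leq_trans _ NJ) // leq_mul2r ltnW ?orbT.
- by rewrite rE mulrA.
- by rewrite hornerM hornerXn mulf_neq0 // expf_neq0.
Qed.

Hypothesis indep : forall M (a : 'I_M * 'I_M * bool -> K),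
  \sum_t a t *: pbw t = 0 -> forall t, a t = 0.

(** The difference p - q is read off from an expression of 0 in the ordered monomials, whose
    coefficients all vanish. *)
Lemma sym_uniq k x p q : sym k x p -> sym k x q -> p = q.
Proof.
move=> sp sq; have := symB sp sq; rewrite subrr => /sym_coef -/(_ _ (ltnSn k)).
move=> [a [_ /esym/indep a0 /eqP]]; rewrite big1; last by move=> t _; rewrite a0 scale0r.
by rewrite subr_eq0 => /eqP.
Qed.

(** The weight is the largest one among monomials with a nonzero coefficient. As N >= 3, only 1 and
    U have weight at most 2; the bound n >= 5 enters here. *)
Lemma gen3_lead x : gen3 U V W x -> x != 0 ->
  exists k p, [/\ sym k x p, mono_or_root k p
    & (k <= 2)%N -> exists a b, x = a *: U + b%:A].
Proof.
move=> /gen3_sym[k0 [p0 /sym_coef -/(_ _ (ltnSn k0))[a [_ xE _]]]] x0.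
have [t1 at1] : exists t1, a t1 != 0.
  apply/existsP; apply: contraNT x0; rewrite negb_exists => /forallP a0.
  by rewrite xE big1 // => t _; move: (a0 t); rewrite negbK => /eqP ->; rewrite scale0r.
have [t0 at0 t0max] := @arg_maxnP _ t1 (fun t => a t != 0) (fun t => weight t) at1.
have {}t0max t : a t != 0 -> (weight t <= weight t0)%N := t0max t.
have [J [r [NJ r0 sr pE]]] := symbol_sumE erefl at0.
exists (weight t0), (\sum_(t | weight t == weight t0) a t *: symbol t); split.
- by rewrite xE; apply: sym_sum => t /t0max.
- by rewrite pE; apply: mono_or_rootP.
move=> w2; rewrite xE; elim/big_ind: _ => [|y z [ay [b ->]] [az [d ->]]|t _].
- by exists 0, 0; rewrite !scale0r addr0.
- by exists (ay + az), (b + d); rewrite !scalerDl addrACA.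
have [->|at_] := eqVneq (a t) 0; first by exists 0, 0; rewrite !scale0r addr0.
have := leq_trans (t0max _ at_) w2; rewrite /weight /wt /pbw.
case: t at_ => [[i j] [|]] /= _; first by lia.
have [->|j0 ] := eqVneq (j : nat) 0%N; last first.
  by have := @leq_pmulr N j; rewrite lt0n j0 => /(_ isT); lia.
rewrite muln0 !addn0 muln0 addn0 !expr0 !mulr1 => i1.
have [->|i0] := eqVneq (i : nat) 0%N; first by exists 0, (a (i, j, false)); rewrite scale0r add0r.
have -> : (i : nat) = 1%N by lia.
by exists (a (i, j, false)), 0; rewrite scale0r addr0 expr1.
Qed.

(** * The Poisson bracket of symbols and iterated commutators *)

Hypothesis PN : P`_N = N.+1%:R.

(** This encodes the bracket with {t, y} = - y: the terms in which the extra powers y^k and y^l are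
    differentiated cancel, and the factor y of {t, y} makes up for the loss of one in weight. *)
Definition bracket k (p : {poly K}) l (q : {poly K}) :=
  (q * p^`()) *+ l - (p * q^`()) *+ k.

Let bracketN k p l q : - bracket k p l q = bracket l q k p.
Proof. by rewrite /bracket opprB. Qed.

Let bracketMr k p l q l' q' :
  bracket k p (l + l') (q * q') = bracket k p l q * q' + q * bracket k p l' q'.
Proof. by rewrite /bracket derivM; ring. Qed.

Let XA : 'X ^+ N.-1 = 'X ^+ N.-2 * 'X :> {poly K}.
Proof. by rewrite -exprSr; congr ('X ^+ _); lia. Qed.
Let XAA : 'X ^+ N = 'X ^+ N.-2 * 'X * 'X :> {poly K}.
Proof. by rewrite -!exprSr; congr ('X ^+ _); lia. Qed.
Let N1 : N.-1%:R = N%:R - 1 :> {poly K}.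
Proof. by rewrite -subn1 natrB //; lia. Qed.

Let deriv_symX : X^`() = - ('X *+ 2).
Proof. by rewrite /X derivN derivXn. Qed.
Let deriv_symY : Y^`() = 'X ^+ N.-2 *+ N.-1 * ('X ^+ 2 + c%:P) + 'X ^+ N.-1 * ('X *+ 2).
Proof. by rewrite /Y derivM derivD !derivXn derivC addr0. Qed.
Let deriv_symZ : Z^`() = 'X ^+ N.-1 *+ N * ('X ^+ 2 - c%:P) + 'X ^+ N * ('X *+ 2).
Proof. by rewrite /Z derivM derivB !derivXn derivC subr0. Qed.

Let bracketXY : bracket 2 X N Y = Z *+ 2.
Proof.
rewrite /bracket deriv_symX deriv_symY /X /Y /Z XA XAA -(mulr_natl _ N.-1) N1.
by ring.
Qed.

Let bracketXZ : bracket 2 X N.+1 Z = - ((X * Y) *+ 2).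
Proof.
rewrite /bracket deriv_symX deriv_symZ /X /Y /Z XA XAA.
by ring.
Qed.

(** This is the top-weight part of [v, w] = v^2 + P(u): the value of [c] makes the coefficient of
    X^N agree with [PN]. *)
Let bracketYZ : bracket N Y N.+1 Z = Y ^+ 2 + N.+1%:R *: X ^+ N.
Proof.
have -> : X ^+ N = - (4 * c)%:P * ('X ^+ N) ^+ 2.
  rewrite c4 exprS mulN1r polyCN opprK rmorphXn rmorphN1 /X (exprNn ('X ^+ 2)).
  by rewrite -!exprM mulnC.
rewrite /bracket deriv_symY deriv_symZ /Y /Z -mul_polyC XA XAA -(mulr_natl _ N.-1) N1.
by rewrite polyCM !polyC_natr; ring.
Qed.

Let comm_UV : U * V - V * U = W *+ 2.
Proof. by rewrite (rel_vu UVW) subKr. Qed.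
Let comm_UW : U * W - W * U = - ((U * V) *+ 2) + W *+ 2 + g%:A.
Proof.
rewrite (rel_wu UVW); move: (U * W) (U * V *+ 2) (W *+ 2) (g%:A) => x a b d.
by rewrite -!addrA opprD (addrA x) subrr add0r !opprD !opprK.
Qed.
Let comm_VW : V * W - W * V = V * V + horner_alg U P.
Proof.
rewrite (rel_wv UVW); move: (V * W) (V * V) (horner_alg U P) => x a b.
by rewrite -!addrA opprD (addrA x) subrr add0r !opprD !opprK.
Qed.

Let sym_UV : sym (1 + N) (U * V - V * U) (bracket 2 X N Y).
Proof. by rewrite comm_UV bracketXY; apply/symMn/sym_W. Qed.

Let sym_UW : sym (1 + N.+1) (U * W - W * U) (bracket 2 X N.+1 Z).
Proof.
have sUV := symM sym_U sym_V; have sW := sym_up sym_W.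
have s1 := sym_lt (sym_scale g sym_1) (isT : (0 < N.+2)%N).
apply: sym_eq (symD (symD (symN (symMn 2 sUV)) (symMn 2 sW)) s1) _ _ _ => //.
by rewrite bracketXZ mul0rn !addr0.
Qed.

Let sym_VW : sym (N + N) (V * W - W * V) (bracket N Y N.+1 Z).
Proof.
have sVV := symM sym_V sym_V.
have := sym_lmul_poly sP sym_1; rewrite addn0 mul2n -addnn !mulr1 PN => sPU.
by rewrite comm_VW bracketYZ; apply: symD.
Qed.

(* The commutator with [x], of weight [k.+1], lowers degrees by one. *)
Let poisson k x p l y q := sym (k + l) (x * y - y * x) (bracket k.+1 p l q).

Let poissonMr k x p l y q l' y' q' : sym l y q -> sym l' y' q' ->
  poisson k x p l y q -> poisson k x p l' y' q' -> poisson k x p (l + l') (y * y') (q * q').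
Proof.
move=> sy sy' pxy pxy'; rewrite /poisson bracketMr.
have s1 := symM pxy sy'; have := symM sy pxy'; rewrite addnCA addnA => s2.
apply: sym_eq (symD s1 s2) _ _ _ => //.
by rewrite mulrBl mulrBr !mulrA addrA subrK.
Qed.

Let poisson1 k x p : poisson k x p 0 1 1.
Proof.
by rewrite /poisson mulr1 mul1r subrr /bracket -polyC1 derivC mulr0 mul0rn subrr; apply: sym_0.
Qed.

Let poissonXr k x p l y q i : sym l y q -> poisson k x p l y q ->
  sym (l * i) (y ^+ i) (q ^+ i) /\ poisson k x p (l * i) (y ^+ i) (q ^+ i).
Proof.
move=> sy pxy; elim: i => [|i [IHs IHp]].
  by rewrite muln0 !expr0; split; [apply: sym_1 | apply: poisson1].
by rewrite mulnS !exprS; split; [apply: symM | apply: poissonMr].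
Qed.

Let poisson_gen k x p : poisson k x p 2 U X -> poisson k x p N V Y ->
  poisson k x p N.+1 W Z -> forall l y q, sym l y q -> poisson k x p l y q.
Proof.
move=> pU pV pW l y q; elim=> {l y q} [i j e|a l y q y' q' _ py _ py'|l y q _ py].
- have [sUi pUi] := poissonXr i sym_U pU; have [sVj pVj] := poissonXr j sym_V pV.
  have [sWe pWe] := poissonXr e sym_W pW.
  by apply: poissonMr pWe => //; [apply: symM | apply: poissonMr].
- apply: sym_eq (sym_lin a py py') erefl _ _.
    by rewrite mulrDr mulrDl -scalerAl -scalerAr opprD addrACA -scalerBr.
  by rewrite /bracket derivD derivZ -!mul_polyC; ring.
- apply: sym_eq (sym_up py) _ erefl _; first by rewrite addnS.
  by rewrite /bracket mul0r -polyC0 derivC mulr0 !mul0rn subrr.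
Qed.

Let poisson_anti k x p l y q : poisson k x p l.+1 y q -> poisson l y q k.+1 x p.
Proof.
rewrite /poisson => /symN; rewrite opprB bracketN => s.
by apply: sym_eq s _ erefl erefl; lia.
Qed.

Let poissonxx k x p : poisson k x p k.+1 x p.
Proof. by rewrite /poisson subrr /bracket subrr; apply: sym_0. Qed.

(** Commutator and bracket are derivations in each argument, so agreement on pairs of generators
    suffices: it is extended in one argument, exchanged by [poisson_anti], then extended in the
    other. The form [l.+1] avoids a truncated k + l - 1. *)
Lemma sym_bracket k x p l y q : sym k x p -> sym l.+1 y q ->
  sym (k + l) (x * y - y * x) (bracket k p l.+1 q).
Proof.
have NE : N = N.-1.+1 by lia.
have pUV : poisson 1 U X N V Y by [].
have pUW : poisson 1 U X N.+1 W Z by [].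
have pVW : poisson N.-1 V Y N.+1 W Z.
  by rewrite /poisson -NE; apply: sym_eq sym_VW _ erefl erefl; lia.
have pVU : poisson N.-1 V Y 2 U X by apply: poisson_anti; rewrite -NE.
have pVV : poisson N.-1 V Y N V Y by rewrite {2}NE; apply: poissonxx.
have pWV : poisson N W Z N V Y by rewrite {2}NE; apply: poisson_anti.
have pWU : poisson N W Z 2 U X by apply: poisson_anti.
move=> sx sy; have gU := poisson_anti (poisson_gen (poissonxx 1 U X) pUV pUW sy).
have gV := poisson_anti (poisson_gen pVU pVV pVW sy).
have gW := poisson_anti (poisson_gen pWU pWV (poissonxx N W Z) sy).
rewrite -NE in gV.
have {gU gV gW} : poisson l y q k x p.
  by apply: (poisson_gen gU gV gW).
rewrite /poisson => /symN; rewrite opprB bracketN => s.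
by apply: sym_eq s _ erefl erefl; lia.
Qed.

Definition ad (u x : E) := u * x - x * u.

Lemma iter_ad_linear u r a x y :
  iter r (ad u) (a *: x + y) = a *: iter r (ad u) x + iter r (ad u) y.
Proof.
elim: r => // r /= ->; rewrite /ad mulrDr mulrDl -scalerAl -scalerAr opprD addrACA.
by rewrite -scalerBr.
Qed.

Lemma iter_adD u r x y : iter r (ad u) (x + y) = iter r (ad u) x + iter r (ad u) y.
Proof. by have := iter_ad_linear u r 1 x y; rewrite !scale1r. Qed.

Lemma iter_ad_scale u r a x : iter r (ad u) (a *: x) = a *: iter r (ad u) x.
Proof.
have iter0 : iter r (ad u) 0 = 0.
  by elim: r => // r /= ->; rewrite /ad mulr0 mul0r subrr.
by have := iter_ad_linear u r a x 0; rewrite iter0 !addr0.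
Qed.

Section Growth.
Variables (u : E) (k : nat) (p : {poly K}).
Hypothesis sup : sym k.+1 u p.

Lemma ad_growth : mono_or_root k.+1 p -> exists b l, (b = U \/ b = V) /\
  forall r, exists q, q != 0 /\ sym (l + r * k) (iter r (ad u) b) q.
Proof.
case=> [[a a0 pE]|[al [m [p1 [al0 /andP[m0 mk] pE p1al]]]]].
(* Here u has symbol a t^(k+1). The coefficient followed is that of t^l y in weight l, which has
   degree l + 1 in the encoding: it is 1 for V, and {t^(k+1), t^l y} = - (k+1) t^(l+k) y keeps it
   nonzero. *)
- exists V, N; split; first by right.
  suff H r : exists q : {poly K}, q`_(N + r * k).+1 != 0 /\ sym (N + r * k) (iter r (ad u) V) q.
    move=> r; have [q [q0 sq]] := H r; exists q; split=> //.
    by apply: contraNneq q0 => ->; rewrite coef0.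
  elim: r => [|r [q [q0 sq]]].
    exists Y; rewrite mul0n addn0; split; last exact: sym_V.
    rewrite /Y mulrDr -exprD coefD coefXn coefMC coefXn.
    have -> : (N.-1 + 2 = N.+1)%N by lia.
    have -> : (N.+1 == N.-1) = false by apply/negbTE; lia.
    by rewrite eqxx mul0r addr0 oner_eq0.
  set l := (N + r * k)%N in q0 sq.
  have lE : l = l.-1.+1 by rewrite /l; lia.
  rewrite lE in sq; have := sym_bracket sup sq; rewrite -lE.
  set q' := bracket _ _ _ _ => sq'; exists q'; split; last first.
    by apply: sym_eq sq' _ erefl erefl; rewrite mulSn /l; lia.
  have -> : (N + r.+1 * k).+1 = (l + k).+1 by rewrite mulSn /l; lia.
  have -> : q'`_(l + k).+1 = - (a * k.+1%:R * q`_l.+1).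
    rewrite /q' /bracket pE derivZ derivXn.
    rewrite /= coefB !coefMn -scalerAr -scalerAl !coefZ (mulrnAr q) coefMn coefMXn coefXnM.
    have -> : ((l + k).+1 < k)%N = false by lia.
    have -> : ((l + k).+1 < k.+1)%N = false by lia.
    have -> : ((l + k).+1 - k = l.+1)%N by lia.
    have -> : ((l + k).+1 - k.+1 = l)%N by lia.
    by rewrite coef_deriv; ring.
  by rewrite oppr_eq0 !mulf_neq0 // pnatr_eq0.
(* The start is U because X does not vanish at [al]. Each bracket with u adds exactly m - 1 to the
   order of vanishing at [al], and the value of the cofactor there is followed. *)
exists U, 2; split; first by left.
suff H r : exists q : {poly K}, q.[al] != 0 /\
    sym (2 + r * k) (iter r (ad u) U) (q * ('X - al%:P) ^+ (r * m.-1)).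
  move=> r; have [q [q0 sq]] := H r; exists (q * ('X - al%:P) ^+ (r * m.-1)); split=> //.
  apply: mulf_neq0; last by rewrite monic_neq0 // monic_exp // monicXsubC.
  by apply: contraNneq q0 => ->; rewrite horner0.
elim: r => [|r [q [q0 sq]]].
  exists X; rewrite !mul0n addn0 expr0 mulr1; split; last exact: sym_U.
  by rewrite /X hornerN hornerXn oppr_eq0 expf_neq0.
set l := (2 + r * k)%N in sq; set s := (r * m.-1)%N in sq.
have lE : l = l.-1.+1 by rewrite /l; lia.
rewrite lE in sq; have := sym_bracket sup sq; rewrite -lE.
set d := 'X - al%:P in sq pE *.
pose h := (q * (p1^`() * d + p1 *+ m)) *+ l - (p1 * (q^`() * d + q *+ s)) *+ k.+1.
have derivXd i : (d ^+ i)^`() * d = d ^+ i *+ i.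
  by rewrite deriv_exp /d derivXsubC mul1r mulrnAl; case: i => [|i]; rewrite ?mulr0n //= -exprSr.
have dN0 : d != 0 by rewrite monic_neq0 // monicXsubC.
have -> : bracket k.+1 p l (q * d ^+ s) = h * d ^+ (r.+1 * m.-1).
  (* After multiplication by [d], the derivative of d^i becomes i d^i for every i, zero included. *)
  apply: (mulIf dN0); rewrite /bracket pE !derivM -[in RHS]mulrA -exprSr.
  have -> : (r.+1 * m.-1).+1 = (m + s)%N by rewrite mulSn /s; lia.
  rewrite exprD mulrBl !mulrnAl.
  have -> : (q * d ^+ s * (p1^`() * d ^+ m + p1 * (d ^+ m)^`())) * d =
            q * d ^+ s * (p1^`() * d ^+ m * d + p1 * ((d ^+ m)^`() * d)) by ring.
  have -> : (p1 * d ^+ m * (q^`() * d ^+ s + q * (d ^+ s)^`())) * d =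
            p1 * d ^+ m * (q^`() * d ^+ s * d + q * ((d ^+ s)^`() * d)) by ring.
  by rewrite !derivXd /h; ring.
move=> sh; exists h; split; last by apply: sym_eq sh _ erefl erefl; rewrite mulSn /l; lia.
(* The factor is l m - (k + 1) s with l = 2 + r k and s = r (m - 1), rearranged so that it is
   visibly positive. *)
have -> : h.[al] = (2 * m + r * (k.+1 - m))%N%:R * (p1.[al] * q.[al]).
  have dal : d.[al] = 0 by rewrite hornerXsubC subrr.
  rewrite /h hornerD hornerN !hornerMn !hornerM !hornerD !hornerM !hornerMn dal.
  rewrite !mulr0 !add0r.
  have -> : (2 * m + r * (k.+1 - m))%N%:R = l%:R * m%:R - k.+1%:R * s%:R :> K.
    have e : (l * m = (2 * m + r * (k.+1 - m)) + k.+1 * s)%N.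
      by rewrite /l /s; case: (m) mk m0 => [|m'] //= mk' _; rewrite subSS; nia.
    by rewrite -!natrM e [in RHS]natrD addrK.
  by ring.
rewrite !mulf_neq0 // pnatr_eq0 -lt0n.
by rewrite addn_gt0 muln_gt0 m0.
Qed.

End Growth.

End Symbols.

(** * The image of the first generator *)

Section QuadraticGenerator.
Variables (K : numClosedFieldType) (E : algType K) (N : nat) (c : K).
Hypothesis N3 : (3 <= N)%N.
Hypothesis c4 : 4 * c = (-1) ^+ N.+1.
Variables (Q P : {poly K}) (g : K) (U V W : E).
Hypothesis UVW : relations Q P g U V W.
Hypothesis Qmonic : Q \is monic.
Hypothesis sQ : size Q = N.+2.
Hypothesis sP : (size P <= N.+1)%N.
Hypothesis PN : P`_N = N.+1%:R.
Hypothesis indep : forall M (a : 'I_M * 'I_M * bool -> K),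
  \sum_t a t *: pbw U V W t = 0 -> forall t, a t = 0.
Variables (Q' P' : {poly K}) (g' : K) (u v w : E).
Hypothesis uvw : relations Q' P' g' u v w.
Hypotheses (Au : gen3 U V W u) (Av : gen3 U V W v) (Aw : gen3 U V W w).
Hypotheses (BU : gen3 u v w U) (BV : gen3 u v w V).

Local Notation sym := (sym N c U V W).

(** Weights are counted twice, so that growth by (k + 1) / 2 per commutator has integer bounds. *)
Let half_bounded n x := exists q, sym n./2 x q.

Let half_bounded_sym k x p : sym k x p -> half_bounded (2 * k) x.
Proof. by move=> sx; exists p; rewrite mul2n doubleK. Qed.

Let half_bounded_le m n x : (m <= n)%N -> half_bounded m x -> half_bounded n x.
Proof.
move=> mn [q sq]; have := half_leq mn; rewrite leq_eqVlt => /predU1P[mnE|mn2].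
  by exists q; rewrite -mnE.
by exists 0; apply: sym_lt sq mn2.
Qed.

Let half_boundedD n x y : half_bounded n x -> half_bounded n y -> half_bounded n (x + y).
Proof. by move=> [p sp] [q sq]; exists (p + q); apply: symD. Qed.

Let half_bounded_scale n a x : half_bounded n x -> half_bounded n (a *: x).
Proof. by move=> [p sp]; exists (a *: p); apply: sym_scale. Qed.

Let half_boundedM m n x y : half_bounded m x -> half_bounded n y -> half_bounded (m + n) (x * y).
Proof.
move=> [p sp] [q sq]; have := symM N3 c4 UVW Qmonic sQ sP sp sq => spq.
have : half_bounded (2 * (m./2 + n./2)) (x * y) by apply: half_bounded_sym spq.
by apply: half_bounded_le; lia.
Qed.

Variables (k : nat) (p : {poly K}).
Hypotheses (su : sym k.+1 u p).

(* Under the flow of [u], elements grow at half the rate of [u] itself: the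
   generators satisfy (ad u)^2 v - 2 (ad u) v + 4 u v = 2 g'. *)
Let slow C x := forall r, half_bounded (C + r * k.+1) (iter r (ad u) x).

Let slow_le C D x : (C <= D)%N -> slow C x -> slow D x.
Proof. by move=> CD sx r; apply: half_bounded_le (sx r); rewrite leq_add2r. Qed.

(** The Leibniz rule is applied one step at a time: the factor hit by [ad u] has its constant raised
    by [k.+1], which pays for that step. *)
Let slowM C D x y : slow C x -> slow D y -> slow (C + D) (x * y).
Proof.
move=> sx sy r; elim: r C D x y sx sy => [|r IHr] C D x y sx sy.
  by rewrite mul0n addn0; apply: half_boundedM;
    [have := sx 0; rewrite mul0n addn0 | have := sy 0; rewrite mul0n addn0].
have slow_ad B z : slow B z -> slow (B + k.+1) (ad u z).
  by move=> sz i; have := sz i.+1; rewrite iterSr mulSn addnA.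
have -> : iter r.+1 (ad u) (x * y) =
    iter r (ad u) (ad u x * y) + iter r (ad u) (x * ad u y).
  by rewrite iterSr -iter_adD; congr (iter r _ _); rewrite /ad mulrBl mulrBr !mulrA addrA subrK.
apply: half_boundedD.
  by apply: half_bounded_le (IHr _ _ _ _ (slow_ad _ _ sx) sy); lia.
by apply: half_bounded_le (IHr _ _ _ _ sx (slow_ad _ _ sy)); lia.
Qed.

Let iter_ad_uM r x : iter r (ad u) (u * x) = u * iter r (ad u) x.
Proof. by elim: r => // r /= ->; rewrite /ad mulrBr !mulrA. Qed.

Let ad_v : ad u v = 2 *: w.
Proof. by rewrite /ad (rel_vu uvw) subKr scaler_nat. Qed.

Let ad_w : ad u w = (- 2) *: (u * v) + (2 *: w + g' *: 1).
Proof.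
rewrite /ad (rel_wu uvw) scaleNr !scaler_nat.
move: (u * w) (u * v *+ 2) (w *+ 2) (g'%:A) => x a b d.
by rewrite -!addrA opprD (addrA x) subrr add0r !opprD !opprK.
Qed.

Let slow_u : slow (2 * k.+1) u.
Proof.
case=> [|r]; first by rewrite addn0; apply: half_bounded_sym su.
have -> : iter r.+1 (ad u) u = 0.
  by elim: r => [|r IHr]; rewrite iterS ?IHr /ad ?mulr0 ?mul0r subrr.
by exists 0; apply: sym_0.
Qed.

(** Up to a multiple of w and a scalar, (ad u)^2 v is a multiple of u v. Two commutators thus cost
    one factor u, of weight k + 1; in the induction the bound for w runs one step ahead of that for
    v. *)
Let slow_vw : exists C, slow C v /\ slow C w.
Proof.
have [lv [pv sv]] := gen3_sym N3 c4 UVW Qmonic sQ sP Av.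
have [lw [pw sw]] := gen3_sym N3 c4 UVW Qmonic sQ sP Aw.
pose C := (2 * (lv + lw))%N.
have H r : half_bounded (C + r * k.+1) (iter r (ad u) v) /\
           half_bounded (C + r.+1 * k.+1) (iter r (ad u) w).
  elim: r => [|r [IHv IHw]].
    by split; [move: (half_bounded_sym sv) | move: (half_bounded_sym sw)];
      apply: half_bounded_le; rewrite /C; lia.
  rewrite !iterSr ad_v ad_w; split.
    by rewrite iter_ad_scale; apply/half_bounded_scale.
  rewrite !iter_ad_linear iter_ad_uM iter_ad_scale.
  apply: half_boundedD.
    apply: half_bounded_scale.
    by apply: half_bounded_le (half_boundedM (half_bounded_sym su) IHv); lia.
  apply: half_boundedD; apply: half_bounded_scale.
    by apply: half_bounded_le IHw; lia.
  case: r {IHv IHw} => [|r].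
    by apply: half_bounded_le (half_bounded_sym (sym_1 N c U V W)); lia.
  have -> : iter r.+1 (ad u) 1 = 0.
    by elim: r => [|r IHr]; rewrite iterS ?IHr /ad ?mulr0 ?mul0r ?mulr1 ?mul1r subrr.
  by exists 0; apply: sym_0.
exists (C + k.+1)%N; split=> r.
  by apply: half_bounded_le (H r).1; lia.
by apply: half_bounded_le (H r).2; rewrite mulSn addnA.
Qed.

Let slow_gen3 x : gen3 u v w x -> exists C, slow C x.
Proof.
have [C [slow_v slow_w]] := slow_vw.
elim=> {x} [|x _ [D sx]|x _ [D sx]|x _ [D sx]|a x y _ [D sx] _ [D' sy]].
- exists 0; case=> [|r]; first by apply: (half_bounded_sym (sym_1 N c U V W)).
  have -> : iter r.+1 (ad u) 1 = 0.
    by elim: r => [|r IHr]; rewrite iterS ?IHr /ad ?mulr0 ?mul0r ?mulr1 ?mul1r subrr.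
  by exists 0; apply: sym_0.
- by eexists; apply: slowM slow_u sx.
- by eexists; apply: slowM slow_v sx.
- by eexists; apply: slowM slow_w sx.
- exists (D + D')%N => r; rewrite iter_ad_linear; apply: half_boundedD.
    by apply: half_bounded_scale; apply: (slow_le (leq_addr D' D) sx).
  by apply: (slow_le (leq_addl D D') sy).
Qed.

Lemma weight_le2 : mono_or_root k.+1 p -> (k.+1 <= 2)%N.
Proof.
move=> mr; rewrite leqNgt; apply/negP => k2.
have [b [l [bUV fast]]] := ad_growth N3 c4 UVW Qmonic sQ sP PN su mr.
have [C slow_b] : exists C, slow C b by case: bUV => ->; apply: slow_gen3.
have [q [q0 sq]] := fast C.+1; have [q' sq'] := slow_b C.+1.
(* With r = C + 1 and k >= 2, C + r (k + 1) < r (k + 2) <= 2 r k. *)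
have lt : ((C + C.+1 * k.+1)./2 < l + C.+1 * k)%N by nia.
have := sym_uniq N3 Qmonic sQ sP indep sq (sym_lt sq' lt) => q00.
by rewrite q00 eqxx in q0.
Qed.

End QuadraticGenerator.

Lemma gen3_affine (K : numClosedFieldType) (E : algType K) (N : nat) (c : K)
    (Q P : {poly K}) (g : K) (U V W : E) (Q' P' : {poly K}) (g' : K) (u v w : E) :
  (3 <= N)%N -> 4 * c = (-1) ^+ N.+1 ->
  relations Q P g U V W -> Q \is monic -> size Q = N.+2 -> (size P <= N.+1)%N ->
  P`_N = N.+1%:R ->
  (forall M (a : 'I_M * 'I_M * bool -> K),
    \sum_t a t *: pbw U V W t = 0 -> forall t, a t = 0) ->
  relations Q' P' g' u v w ->
  gen3 U V W u -> gen3 U V W v -> gen3 U V W w -> gen3 u v w U -> gen3 u v w V ->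
  exists a b, u = a *: U + b%:A.
Proof.
move=> N3 c4 UVW Qmonic sQ sP PN indep uvw Au Av Aw BU BV.
have [->|u0] := eqVneq u 0; first by exists 0, 0; rewrite !scale0r addr0.
have [k [p [sk mr k2]]] := gen3_lead N3 c4 UVW Qmonic sQ sP Au u0.
apply: k2; case: k sk mr => // k su mr.
exact: (weight_le2 N3 c4 UVW Qmonic sQ sP PN indep uvw Av Aw BU BV su mr).
Qed.

(** * Leading coefficients of difference operators *)

Section LeadingForms.
Variable K : numClosedFieldType.
Local Notation E := (endo K).
Implicit Types (S T : E) (p q : {poly K}) (J : nat).

Lemma endo_sumE (I : Type) (r : seq I) (R : pred I) (F : I -> E) f m :
  (\sum_(i <- r | R i) F i) f m = \sum_(i <- r | R i) F i f m.
Proof. by elim/big_ind2: _ => // S x T y Sx Ty; rewrite endoD Sx Ty. Qed.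

(* The base point 'i keeps all denominators away from zero. *)
Definition node (m : int) : K := 'i + m%:~R.

Lemma node_real_neq0 (x : K) : x \is Num.real -> 'i + x != 0.
Proof.
move=> xR; apply/eqP => /eqP; rewrite addr_eq0 => /eqP ix.
have : 'i ^+ 2 = x ^+ 2 :> K by rewrite ix sqrrN.
rewrite sqrCi => x2; have : 0 <= x ^+ 2 by rewrite real_exprn_even_ge0.
by rewrite -x2 oppr_ge0 ler10.
Qed.

Lemma node_neq (m : int) (x : K) : x \is Num.real -> node m - x != 0.
Proof.
move=> xR; rewrite /node -addrA node_real_neq0 // rpredB // ?realz //.
Qed.

Lemma node_inj : injective node.
Proof. by move=> m n /addrI /eqP; rewrite eqr_int => /eqP. Qed.

Lemma node_poly_eq0 p : (forall m, p.[node m] = 0) -> p = 0.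
Proof.
move=> p0; apply/eqP; apply: contraT => pN0.
have := @max_poly_roots _ p [seq node (Posz i) | i <- iota 0 (size p)] pN0.
rewrite size_map size_iota ltnn; apply.
  by apply/allP => _ /mapP[i _ ->]; rewrite rootE p0.
rewrite map_inj_uniq ?iota_uniq // => i j /node_inj; by case.
Qed.

Lemma nodeD m (J : nat) : node (m + J%:Z) = node m + J%:R.
Proof. by rewrite /node intrD addrA. Qed.

(* [top J p T]: the matrix of [T] has no entries beyond the [J]-th diagonal
   above the main one, on which its entries are the values of [p]. *)
Definition top J p T := forall f m, (forall l, l < m + J%:Z -> f l = 0) ->
  T f m = p.[node m] * f (m + J%:Z).

Definition shift J p := p \Po ('X + J%:R%:P).

Lemma horner_shift J p x : (shift J p).[x] = p.[x + J%:R].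
Proof. by rewrite /shift horner_comp !hornerE. Qed.

Lemma top_uniq J p q T : top J p T -> top J q T -> p = q.
Proof.
move=> tp tq; apply/eqP; rewrite -subr_eq0; apply/eqP/node_poly_eq0 => m.
pose f (l : int) : K := (l == m + J%:Z)%:R.
have f0 l : l < m + J%:Z -> f l = 0 by rewrite /f => /lt_eqF ->.
have := tp f m f0; rewrite (tq f m f0) /f eqxx !mulr1 hornerD hornerN => ->.
by rewrite subrr.
Qed.

Lemma topM J p S J' p' T : top J p S -> top J' p' T ->
  top (J + J') (p * shift J p') (S * T).
Proof.
move=> tS tT f m f0; rewrite endoM tS.
  rewrite tT; last by move=> l lm; apply: f0; rewrite PoszD addrA.
  by rewrite hornerM horner_shift nodeD PoszD addrA mulrA.
move=> l lm; rewrite tT => [|i il]; last first.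
  by apply: f0; apply: lt_trans il _; rewrite PoszD addrA ltrD2r.
by rewrite f0 ?mulr0 // PoszD addrA ltrD2r.
Qed.

Lemma topD J p S q T : top J p S -> top J q T -> top J (p + q) (S + T).
Proof. by move=> tS tT f m f0; rewrite endoD tS // tT // hornerD mulrDl. Qed.

Lemma topZ J a p T : top J p T -> top J (a *: p) (a *: T).
Proof. by move=> tT f m f0; rewrite endoZ tT // hornerZ mulrA. Qed.

Lemma topN J p T : top J p T -> top J (- p) (- T).
Proof. by move=> /(topZ (-1)); rewrite !scaleN1r. Qed.

Lemma topB J p S q T : top J p S -> top J q T -> top J (p - q) (S - T).
Proof. by move=> tS tT; apply/topD/topN. Qed.

Lemma top1 : top 0 1 1.
Proof. by move=> f m _; rewrite hornerC mul1r addr0. Qed.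

Lemma top0 J : top J 0 0.
Proof. by move=> f m _; rewrite horner0 mul0r. Qed.

Lemma top_lt J J' p T : (J < J')%N -> top J p T -> top J' 0 T.
Proof.
move=> JJ' tT f m f0; rewrite tT => [|l lm].
  by rewrite f0 ?mulr0 ?horner0 ?mul0r // ltrD2l ltz_nat.
by apply: f0; apply: lt_trans lm _; rewrite ltrD2l ltz_nat.
Qed.

Lemma top_horner L p T : top 0 L T -> top 0 (p \Po L) (horner_alg T p).
Proof.
move=> tT; rewrite (horner_alg_sum _ (leqnn _)) comp_polyE.
have tX i : top 0 (L ^+ i) (T ^+ i).
  elim: i => [|i IHi]; first exact: top1.
  rewrite !exprS; have := topM tT IHi.
  by rewrite /shift addr0 comp_polyXr.
elim/big_ind2: _ => [|????|i _]; [exact: top0 | exact: topD | exact: topZ].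
Qed.

Section Generators.
Variables (u v w : E) (L p d : {poly K}) (J : nat).
Hypotheses (J0 : (0 < J)%N) (sL : size L = 3%N) (sd : size d = 2%N) (p0 : p != 0).
Hypotheses (tu : top 0 L u) (tv : top J p v) (tw : top J (p * d) w).

Definition lead_prod j := \prod_(i < j) shift (J * i) p.

Lemma size_shift i q : size (shift i q) = size q.
Proof. by rewrite /shift size_comp_poly2 // size_XaddC. Qed.

Lemma lead_prod_neq0 j : lead_prod j != 0.
Proof. by apply/prodf_neq0 => i _; rewrite -size_poly_gt0 size_shift size_poly_gt0. Qed.

Let top_pbw M (t : 'I_M * 'I_M * bool) : top (J * level t)
  (L ^+ t.1.1 * (lead_prod (level t) * shift (J * t.1.2) d ^+ t.2)) (pbw u v w t).
Proof.
case: t => [[i j] e]; rewrite /level /pbw /=.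
have tuX : top 0 (L ^+ i) (u ^+ i).
  by have := top_horner 'X^i tu; rewrite comp_Xn_poly rmorphXn /= horner_algX.
have tvX (j' : nat) : top (J * j') (lead_prod j') (v ^+ j').
  elim: j' => [|j' IHj]; first by rewrite muln0 /lead_prod big_ord0; apply: top1.
  by rewrite mulnSr exprSr /lead_prod big_ord_recr; apply: topM.
have shift0 q : shift 0 q = q by rewrite /shift addr0 comp_polyXr.
rewrite -mulrA -[(J * _)%N]add0n -[X in _ * X]shift0; apply: topM => //.
case: e => /=; last by rewrite addn0 !expr0 !mulr1.
rewrite addn1 mulnSr !expr1 /lead_prod big_ord_recr /= -mulrA.
have -> : shift (J * j) p * shift (J * j) d = shift (J * j) (p * d).
  by rewrite /shift comp_polyM.
exact: topM.
Qed.

(** [L] has degree 2 and [q] degree 1, so A(L) has even degree and B(L) q odd degree: nonzero terms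
    cannot cancel. *)
Let comp_parity_eq0 (A B q : {poly K}) : size q = 2%N ->
  (A \Po L) + (B \Po L) * q = 0 -> A = 0 /\ B = 0.
Proof.
move=> sq /eqP; rewrite addr_eq0 => /eqP AB.
have sc (C : {poly K}) : C != 0 -> size (C \Po L) = (2 * (size C).-1).+1.
  move=> C0; have CL0 : C \Po L != 0 by rewrite comp_poly_eq0 ?sL.
  by rewrite -[LHS]prednK ?size_poly_gt0 // size_comp_poly sL mulnC.
have q0 : q != 0 by rewrite -size_poly_gt0 sq.
have [B0|B0] := eqVneq B 0.
  split=> //; apply/eqP; move: AB; rewrite B0 comp_poly0 mul0r oppr0 => /eqP.
  by rewrite comp_poly_eq0 ?sL.
have BL0 : B \Po L != 0 by rewrite comp_poly_eq0 ?sL.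
have := congr1 (fun q : {poly K} => size q) AB; rewrite /= size_polyN size_mul // (sc B) // sq.
have [->|A0] := eqVneq A 0; first by rewrite comp_poly0 size_poly0; lia.
by rewrite (sc A) //; lia.
Qed.

(** [l] is the largest level that occurs. There [A] gathers the monomials u^i v^l and [B] the
    monomials u^i v^(l-1) w; [comp_parity_eq0] prevents cancellation. In level 0 the truncated
    [l.-1] is harmless because [B] is zero. *)
Lemma lead_sum M (a : 'I_M * 'I_M * bool -> K) t1 : a t1 != 0 ->
  exists l (A B : {poly K}),
  [/\ (A \Po L) + (B \Po L) * shift (J * l.-1) d != 0,
      top (J * l) (lead_prod l * ((A \Po L) + (B \Po L) * shift (J * l.-1) d))
        (\sum_t a t *: pbw u v w t)
    & l = 0%N -> B = 0 /\ \sum_t a t *: pbw u v w t = horner_alg u A].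
Proof.
move=> at1.
have [t0 at0 t0max] := @arg_maxnP _ t1 (fun t => a t != 0) (fun t => level t) at1.
have {}t0max t : a t != 0 -> (level t <= level t0)%N := t0max t.
pose l := level t0; exists l.
pose A := \sum_(t | (level t == l) && ~~ t.2) a t *: 'X^(t.1.1) : {poly K}.
pose B := \sum_(t | (level t == l) && t.2) a t *: 'X^(t.1.1) : {poly K}.
exists A, B; split.
- have sd' : size (shift (J * l.-1) d) = 2%N by rewrite size_shift.
  (* The level and the exponent of w determine that of v, so [a t0] is a single coefficient of [A]
     or of [B]. *)
  apply: contra_neq at0 => /(comp_parity_eq0 sd')[A0 B0].
  have [e0|e0] := boolP t0.2.
    have := congr1 (fun q : {poly K} => q`_t0.1.1) B0; rewrite coef0 coef_sum.
    rewrite (bigD1 t0) /=; last by rewrite e0 eqxx.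
    rewrite coefZ coefXn eqxx mulr1 big1 ?addr0 // => t /andP[/andP[/eqP tl te] tt0].
    rewrite coefZ coefXn; case: eqP => [it|]; last by rewrite mulr0.
    case/eqP: tt0; move: tl te e0 it; rewrite /l /level.
    case: t t0 {t0max l A B A0 B0 sd'} => [[i j] e] [[i' j'] e'] /= jj ee ee' ii.
    move: jj; rewrite ee ee' => jj.
    by congr (_, _, _); apply/val_inj => /=; [rewrite ii | lia].
  have := congr1 (fun q : {poly K} => q`_t0.1.1) A0; rewrite coef0 coef_sum.
  rewrite (bigD1 t0) /=; last by rewrite e0 eqxx.
  rewrite coefZ coefXn eqxx mulr1 big1 ?addr0 // => t /andP[/andP[/eqP tl te] tt0].
  rewrite coefZ coefXn; case: eqP => [it|]; last by rewrite mulr0.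
  case/eqP: tt0; move: tl te e0 it; rewrite /l /level.
  case: t t0 {t0max l A B A0 B0 sd'} => [[i j] e] [[i' j'] e'] /= jj.
  move=> /negbTE ee /negbTE ee' ii; move: jj; rewrite ee ee' => jj.
  by congr (_, _, _); apply/val_inj => /=; [rewrite ii | lia].
- have -> : lead_prod l * ((A \Po L) + (B \Po L) * shift (J * l.-1) d) =
      \sum_(t | level t == l) a t *: (L ^+ t.1.1 * (lead_prod l * shift (J * t.1.2) d ^+ t.2)).
    rewrite (bigID (fun t : 'I_M * 'I_M * bool => t.2)) /= addrC mulrDr; congr (_ + _).
      rewrite /A linear_sum /= mulr_sumr; apply: eq_bigr => t /andP[_ /negPf ->].
      by rewrite linearZ /= comp_Xn_poly expr0 mulr1 -scalerAr mulrC.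
    rewrite /B linear_sum /= mulr_suml mulr_sumr; apply: eq_bigr => t /andP[/eqP tl te].
    rewrite linearZ /= comp_Xn_poly te expr1 -scalerAl -scalerAr; congr (_ *: _).
    have -> : l.-1 = t.1.2 by rewrite -tl /level te addn1.
    by rewrite mulrCA.
  rewrite [X in top _ X _]big_mkcond /=.
  elim/big_ind2: _ => [|????|t _]; [exact: top0 | exact: topD |].
  case: eqP => [tl|/eqP tl]; first by apply: topZ; have := @top_pbw M t; rewrite tl.
  have [->|/t0max] := eqVneq (a t) 0; first by rewrite scale0r; apply: top0.
  rewrite leq_eqVlt (negPf tl) /= => tlt.
  rewrite -[X in top _ X _](scaler0 _ (a t)); apply: topZ.
  by apply: top_lt (@top_pbw M t); rewrite ltn_pmul2l.
move=> l0; split.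
  by rewrite /B big1 // => t /andP[/eqP tl te]; move: tl; rewrite l0 /level te addn1.
rewrite /A linear_sum /= [RHS]big_mkcond /=; apply: eq_bigr => t _.
rewrite linearZ rmorphXn /= horner_algX -scalerAl mul1r.
case: ifP => [/andP[/eqP tl /negPf te]|tl].
  move: tl; rewrite l0 /level te addn0 => tj.
  by rewrite /pbw te tj !expr0 !mulr1.
have [->|/t0max] := eqVneq (a t) 0; first by rewrite scale0r.
rewrite -/l l0 leqn0 => tl0; move: tl; rewrite l0 tl0 /= => /negbFE te.
by move: tl0; rewrite /level te addn1.
Qed.

End Generators.
End LeadingForms.

(** * The difference operator model *)

Section Model.
Variables (K : numClosedFieldType) (Q P : {poly K}) (g : K).
Hypothesis QP : forall s, Q.[- (s * (s - 1))] - Q.[- (s * (s + 1))] =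
  (s - 1) * P.[- (s * (s - 1))] + (s + 1) * P.[- (s * (s + 1))].

Definition diag_u (s : K) := - (s * (s - 1)).
(** The relation for [w * u] forces 2 u h = g for the diagonal part h of v. *)
Definition diag_v (s : K) := - g / (2 * (s * (s - 1))).
(** The relations for [w * v] and [w * w] express P(u) and Q(u) through the lower coefficients at s
    and s + 1 ([P_lower], [Q_lower]). In Q + s P the one at s + 1 is eliminated, which gives this
    formula. *)
Definition lower_v (s : K) :=
  (Q.[diag_u s] + s * P.[diag_u s] + g ^+ 2 / (4 * (s - 1) ^+ 2)) /
  ((2 * s - 3) * (2 * s - 1)).

Program Definition model_u := @Endo K (fun f m => diag_u (node K m) * f m) _.
Next Obligation. by ring. Qed.

Program Definition model_v := @Endo K (fun f m => f (m + 1) +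
  diag_v (node K m) * f m + lower_v (node K m) * f (m - 1)) _.
Next Obligation. by ring. Qed.

Program Definition model_w := @Endo K (fun f m => node K m * f (m + 1) +
  (1 - node K m) * lower_v (node K m) * f (m - 1)) _.
Next Obligation. by ring. Qed.

Local Notation U := model_u.
Local Notation V := model_v.
Local Notation W := model_w.

Lemma model_uX i f m : (U ^+ i) f m = diag_u (node K m) ^+ i * f m.
Proof.
elim: i f m => [|i IHi] f m; first by rewrite !expr0 mul1r.
by rewrite !exprS endoM /= IHi mulrA.
Qed.

Lemma model_horner p f m : (horner_alg U p) f m = p.[diag_u (node K m)] * f m.
Proof.
rewrite (horner_alg_sum _ (leqnn _)) endo_sumE horner_coef mulr_suml.
by apply: eq_bigr => i _; rewrite endoZ model_uX mulrA.
Qed.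

Let nodeD1 m : node K (m + 1) = node K m + 1.
Proof. by rewrite (nodeD K m 1). Qed.
Let nodeB1 m : node K (m - 1) = node K m - 1.
Proof. by rewrite -[in RHS](subrK 1 m) nodeD1 addrK. Qed.

Let diag_v_u m : g = 2 * diag_u (node K m) * diag_v (node K m).
Proof.
have s0 := @node_neq K m 0 (rpred0 _); have s1 := @node_neq K m 1 (rpred1 _).
rewrite subr0 in s0; rewrite /diag_v /diag_u; move: (node K m) s0 s1 => s s0 s1.
by field; rewrite s0 s1.
Qed.

Let real_frac (a b : int) : (a%:~R / b%:~R : K) \is Num.real.
Proof. by rewrite rpred_div // realz. Qed.

(** The denominators of the model vanish at real points only, and no node is real. *)
Let denominators m (s := node K m) :
  [/\ s != 0, s - 1 != 0, 2 * s - 1 != 0, 2 * s - 3 != 0 & 2 * s + 1 != 0] /\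
  s + 1 != 0 /\ s - 2 != 0.
Proof.
have two : 2 != 0 :> K by rewrite pnatr_eq0.
have half (a : int) : 2 * s - a%:~R != 0.
  have -> : 2 * s - a%:~R = 2 * (s - a%:~R / 2%:~R) by field.
  by rewrite mulf_neq0 // node_neq.
have int_neq (a : int) : s - a%:~R != 0 by rewrite node_neq // realz.
split; first split.
- by have := int_neq 0; rewrite subr0.
- exact: (int_neq 1).
- exact: (half 1).
- exact: (half 3).
- by have := half (-1); rewrite rmorphN opprK.
split; last exact: (int_neq 2).
by have := int_neq (-1); rewrite rmorphN opprK.
Qed.

Let diag_vD m (s := node K m) : diag_v (s + 1) = diag_v s * (s - 1) / (s + 1).
Proof.
have [[s0 s1 _ _ _] [s2 _]] := denominators m; rewrite /diag_v -/s.
by field; rewrite ?addrK s0 s1 s2.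
Qed.

Let diag_vB m (s := node K m) : diag_v (s - 1) = diag_v s * s / (s - 2).
Proof.
have [[s0 s1 _ _ _] [_ s2]] := denominators m; rewrite /diag_v -/s.
by field; rewrite s0 s1 s2.
Qed.

(** This is what Q - (s - 1) P gives after elimination of the coefficient at s. It agrees with the
    definition translated by one because of the companion identity [QP]. *)
Let lower_vD m (s := node K m) : lower_v (s + 1) =
  (Q.[diag_u s] - (s - 1) * P.[diag_u s] + g ^+ 2 / (4 * s ^+ 2)) /
  ((2 * s - 1) * (2 * s + 1)).
Proof.
have [[s0 s1 s2 s3 s4] _] := denominators m; rewrite /lower_v addrK -/s.
have -> : diag_u (s + 1) = - (s * (s + 1)) by rewrite /diag_u; ring.
have -> : Q.[diag_u s] = Q.[- (s * (s + 1))] + (s - 1) * P.[diag_u s] +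
    (s + 1) * P.[- (s * (s + 1))].
  by rewrite /diag_u -[LHS](subrK Q.[- (s * (s + 1))]) QP; ring.
have -> : 2 * (s + 1) - 3 = 2 * s - 1 by ring.
have -> : 2 * (s + 1) - 1 = 2 * s + 1 by ring.
by congr (_ / _); congr (_ + _); ring.
Qed.

Let P_lower m (s := node K m) : P.[diag_u s] =
  (2 * s - 3) * lower_v s - (2 * s + 1) * lower_v (s + 1) - diag_v s ^+ 2.
Proof.
have [[s0 s1 s2 s3 s4] _] := denominators m; rewrite lower_vD /lower_v /diag_v -/s.
by field; rewrite s0 s1 s2 s3 s4.
Qed.

Let Q_lower m (s := node K m) : Q.[diag_u s] = s * (2 * s + 1) * lower_v (s + 1) +
  (s - 1) * (2 * s - 3) * lower_v s + diag_u s * diag_v s ^+ 2.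
Proof.
have [[s0 s1 s2 s3 s4] _] := denominators m; rewrite lower_vD /lower_v /diag_v -/s.
move: Q.[_] P.[_] => q p; rewrite /diag_u.
by field; rewrite s0 s1 s2 s3 s4.
Qed.

Lemma model_relations : relations Q P g U V W.
Proof.
split; apply: endoP => f m; rewrite ?mulr2n !(endoM, endoD, endoN, endoZ, endo1E, model_horner) /=
  ?nodeD1 ?nodeB1 ?addrK ?subrK.
- by rewrite /diag_u; ring.
- have e := diag_v_u m; move: e; rewrite /diag_u.
  move: (f _) (f _) (f _) => f0 f1 f2; move: (diag_v _) (lower_v _) => h l; move: (node K m) => s e.
  by rewrite e; ring.
- have [[s0 s1 s2 s3 s4] [s5 s6]] := denominators m; rewrite P_lower diag_vD diag_vB.
  move: (lower_v (node K m)) (lower_v (node K m + 1)) (lower_v (node K m - 1)) => l0 l1 l2.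
  move: (diag_v _) => h; move: (node K m) s0 s1 s2 s3 s4 s5 s6 => s s0 s1 s2 s3 s4 s5 s6.
  by field; rewrite s5 s6.
- have [[s0 s1 s2 s3 s4] [s5 s6]] := denominators m.
  have e := diag_v_u m; rewrite Q_lower diag_vD diag_vB.
  move: (lower_v (node K m)) (lower_v (node K m + 1)) (lower_v (node K m - 1)) => l0 l1 l2.
  move: e; rewrite /diag_u.
  move: (diag_v _) => h; move: (node K m) s0 s1 s2 s3 s4 s5 s6 => s s0 s1 s2 s3 s4 s5 s6 e.
  by rewrite e; field; rewrite s5 s6.
Qed.

Definition top_u : {poly K} := - ('X * ('X - 1)).

Lemma size_top_u : size top_u = 3%N.
Proof.
have -> : top_u = - (('X - 0%:P) * ('X - 1%:P)) by rewrite subr0.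
by rewrite size_polyN size_mul ?polyXsubC_eq0 // !size_XsubC.
Qed.

Lemma top_model_u : top 0 top_u U.
Proof. by move=> f m _; rewrite /= addr0 /top_u !hornerE. Qed.

Lemma top_model_v : top 1 1 V.
Proof.
move=> f m f0; rewrite /= (f0 m) ?(f0 (m - 1)) ?hornerC ?mul1r ?mulr0 ?addr0 //.
  by lia.
by lia.
Qed.

Lemma top_model_w : top 1 (1 * 'X) W.
Proof.
move=> f m f0; rewrite /= (f0 (m - 1)) ?mul1r ?hornerX ?mulr0 ?addr0 //.
by lia.
Qed.

Lemma model_lead M (a : 'I_M * 'I_M * bool -> K) t1 : a t1 != 0 ->
  exists l (A B : {poly K}),
  [/\ (A \Po top_u) + (B \Po top_u) * shift l.-1 'X != 0,
      top l ((A \Po top_u) + (B \Po top_u) * shift l.-1 'X) (\sum_t a t *: pbw U V W t)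
    & l = 0%N -> B = 0 /\ \sum_t a t *: pbw U V W t = horner_alg U A].
Proof.
move=> /(lead_sum (isT : (0 < 1)%N) size_top_u (size_polyX K) (oner_neq0 _) top_model_u
  top_model_v top_model_w)[l [A [B [AB0 tAB l0]]]].
exists l, A, B; move: AB0 tAB; rewrite !mul1n => AB0 tAB; split=> //.
suff lp : lead_prod (1 : {poly K}) 1 l = 1 by rewrite lp mul1r in tAB.
by rewrite /lead_prod big1 // => i _; rewrite /shift comp_polyC.
Qed.

Lemma model_indep M (a : 'I_M * 'I_M * bool -> K) :
  \sum_t a t *: pbw U V W t = 0 -> forall t, a t = 0.
Proof.
move=> s0 t; apply: contraTeq isT => /model_lead[l [A [B [AB0 + _]]]].
by rewrite s0 => /(top_uniq (@top0 K l)) AB; rewrite -AB eqxx in AB0.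
Qed.

Lemma model_w_neq0 : W != 0.
Proof.
apply/eqP => W0; have := top_model_w; rewrite W0 => /(top_uniq (@top0 K 1)) /esym/eqP.
by rewrite mul1r polyX_eq0.
Qed.

End Model.

(** * Rigidity *)

(** Serves in [rigidity] to compare two expressions of a multiple of [W * U]; there [t] is the
    product of U and the polynomial part of v. *)
Lemma zmod_cancel (Z : zmodType) (x a b t d e e' : Z) :
  x = a + (b + t) *+ 2 - d - e -> x = a + b *+ 2 - d - e' -> t *+ 2 + (e' - e) = 0.
Proof.
move=> ->; rewrite mulrnDl addrA (addrAC _ (t *+ 2)) -(addrA _ (t *+ 2)) => /addrI te.
by rewrite addrA addrAC te addNr.
Qed.

Section Rigidity.
Variables (K : numClosedFieldType) (N : nat).
Hypothesis N3 : (3 <= N)%N.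
Variables (Q' P' : {poly K}) (g' : K).
Hypotheses (Qmonic' : Q' \is monic) (sQ' : size Q' = N.+2) (sP' : (size P' <= N.+1)%N).
Hypothesis PN' : P'`_N = N.+1%:R.
Hypothesis QP' : forall s, Q'.[- (s * (s - 1))] - Q'.[- (s * (s + 1))] =
  (s - 1) * P'.[- (s * (s - 1))] + (s + 1) * P'.[- (s * (s + 1))].
Variables (Q P : {poly K}) (g : K).
Hypotheses (Qmonic : Q \is monic) (sQ : size Q = N.+2) (sP : (size P <= N.+1)%N).
Variables (u v w : endo K).
Hypothesis uvw : relations Q P g u v w.

Local Notation E := (endo K).
Local Notation U := (model_u K : E).
Local Notation V := (model_v Q' P' g' : E).
Local Notation W := (model_w Q' P' g' : E).

Hypotheses (Au : gen3 U V W u) (Av : gen3 U V W v) (Aw : gen3 U V W w).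
Hypotheses (BU : gen3 u v w U) (BV : gen3 u v w V).

Let c : K := (-1) ^+ N.+1 / 4.
Let c4 : 4 * c = (-1) ^+ N.+1.
Proof. by rewrite /c; field. Qed.

Let UVW : relations Q' P' g' U V W := model_relations g' QP'.

Let span_UVW x : gen3 U V W x -> exists M (a : 'I_M * 'I_M * bool -> K),
  x = \sum_t a t *: pbw U V W t.
Proof.
move=> /(gen3_sym N3 c4 UVW Qmonic' sQ' sP')[k [p sx]].
have [a [_ xE _]] := sym_coef N3 Qmonic' sQ' sP' sx (ltnSn k).
by exists k.+1, a.
Qed.

Let span_uvw x : gen3 u v w x -> exists M (a : 'I_M * 'I_M * bool -> K),
  x = \sum_t a t *: pbw u v w t.
Proof.
move=> /(gen3_sym N3 c4 uvw Qmonic sQ sP)[k [p sx]].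
have [a [_ xE _]] := sym_coef N3 Qmonic sQ sP sx (ltnSn k).
by exists k.+1, a.
Qed.

Let nonzero_coef (F : E) M (b : 'I_M * 'I_M * bool -> K) (e : 'I_M * 'I_M * bool -> E) :
  F = \sum_t b t *: e t -> F != 0 -> exists t, b t != 0.
Proof.
move=> FE F0; apply/existsP; apply: contraNT F0; rewrite negb_exists => /forallP b0.
by rewrite FE big1 // => t _; move: (b0 t); rewrite negbK => /eqP ->; rewrite scale0r.
Qed.

Let horner_alg_eq0 f : horner_alg U f = 0 -> f = 0.
Proof.
move=> f0; have := top_horner f (@top_model_u K).
rewrite f0 => /(top_uniq (@top0 K 0)) /esym/eqP.
by rewrite comp_poly_eq0 ?size_top_u // => /eqP.
Qed.

Let double_eq0 (x : E) : x *+ 2 = 0 -> x = 0.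
Proof.
rewrite -scaler_nat => /eqP; rewrite scaler_eq0 pnatr_eq0 /= => /eqP //.
Qed.

Let wE : w = 2^-1 *: (u * v - v * u).
Proof.
rewrite (rel_vu uvw) subKr -scaler_nat scalerA mulVf ?scale1r //.
by rewrite pnatr_eq0.
Qed.

Let ncommUV : ~ GRing.comm U V.
Proof.
move=> UV; have /double_eq0 W0 : W *+ 2 = 0.
  by rewrite -(subKr (U * V) (W *+ 2)) -(rel_vu UVW) UV subrr.
by have := model_w_neq0 Q' P' g'; rewrite W0 eqxx.
Qed.

Let w_eq0 : GRing.comm u v -> w = 0.
Proof. by move=> uv; rewrite wE uv subrr scaler0. Qed.

(** Otherwise v commutes with u, so w = 0, and U commutes with u, v, w and hence with V, which they
    generate. *)
Let ncommUv a b : u = a *: U + b%:A -> ~ GRing.comm U v.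
Proof.
move=> uE Uv; apply: ncommUV.
have Uu : GRing.comm U u.
  by rewrite uE /GRing.comm mulrDr mulrDl -!scalerAr -!scalerAl mulr1 mul1r.
have uv : GRing.comm u v.
  by rewrite uE /GRing.comm mulrDr mulrDl -!scalerAr -!scalerAl mulr1 mul1r Uv.
apply: (gen3_comm Uu Uv _ BV).
by rewrite w_eq0 //; apply: commr0.
Qed.

Lemma rigidity : Q = Q' /\ g ^+ 2 = g' ^+ 2.
Proof.
have [al [be uE]] := gen3_affine N3 c4 UVW Qmonic' sQ' sP' PN' (@model_indep _ Q' P' g')
  uvw Au Av Aw BU BV.
have ncomm := ncommUv uE.
(* If [al] is 0, then u is a scalar and w = 0, so U, which u, v, w generate, commutes with v. *)
have al0 : al != 0.
  apply/eqP => al0; apply: ncomm.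
  have uv : GRing.comm v u.
    by rewrite uE al0 scale0r add0r /GRing.comm -scalerAl -scalerAr mul1r mulr1.
  have w0 : w = 0 by apply/w_eq0/esym.
  apply: commr_sym; apply: (gen3_comm uv (commr_refl _) _ BU).
  by rewrite w0; apply: commr0.
(* In level zero v would be a polynomial in U and commute with U. *)
have [l [p [l0 p0 tv]]] : exists l p, [/\ (0 < l)%N, p != 0 & top l p v].
  have [v0|v0] := eqVneq v 0.
    by case: ncomm; rewrite v0; apply: commr0.
  have [M [a vE]] := span_UVW Av; have [t1 at1] := nonzero_coef vE v0.
  have [l [A [B [AB0 tAB l0]]]] := @model_lead _ Q' P' g' _ _ _ at1.
  case: l AB0 tAB l0 => [|l] AB0 tAB l0; last first.
    pose q := (A \Po top_u K) + (B \Po top_u K) * shift l.+1.-1 'X.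
    by exists l.+1, q; rewrite vE; split; [|exact: AB0|exact: tAB].
  case: ncomm; rewrite vE (l0 erefl).2 -[X in GRing.comm X _](horner_algX U).
  by rewrite /GRing.comm -!rmorphM mulrC.
pose L := al *: top_u K + be%:P; pose R := shift l L.
have hL x : L.[x] = - al * (x * (x - 1)) + be.
  by rewrite /L /top_u -polyC1 !(hornerD, hornerN, hornerZ, hornerM, hornerX, hornerC); ring.
have hR x : R.[x] = - al * ((x + l%:R) * (x + l%:R - 1)) + be.
  by rewrite horner_shift hL.
have tu : top 0 L u.
  rewrite uE; apply: topD; first exact/topZ/top_model_u.
  by have := topZ be (@top1 K); rewrite -mul_polyC mulr1.
pose d := 2^-1 *: (L - R).
have shift0 (q : {poly K}) : shift 0 q = q by rewrite /shift addr0 comp_polyXr.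
have tw : top l (p * d) w.
  rewrite wE; have t1 := topM tu tv; have := topM tv tu; rewrite addn0 => t2.
  have := topZ 2^-1 (topB t1 t2); rewrite shift0 /d.
  by rewrite [L * p]mulrC -mulrBr scalerAr.
have eqLR : p * d * R = L * (p * d) + (L * p) *+ 2 - (p * d) *+ 2.
  have t1 := topM tw tu; rewrite addn0 in t1.
  have t2 := topM tu tw; rewrite shift0 in t2.
  have t3 := topM tu tv; rewrite shift0 in t3.
  have tg : top l 0 (g%:A) by apply: top_lt l0 _; apply: topZ; apply: top1.
  rewrite (rel_wu uvw) in t1.
  have := topB (topB (topD t2 (topD t3 t3)) (topD tw tw)) tg.
  by rewrite -!mulr2n subr0 => /(top_uniq t1).
(* With R = L - 2 d, the previous identity divided by p amounts to d^2 - d + L = 0, of which this is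
   the symmetric form. *)
have {}eqLR : (L - R) ^+ 2 + (L + R) *+ 2 = 0.
  apply: (mulfI p0); rewrite mulr0; move/eqP: eqLR; rewrite -subr_eq0 => /eqP.
  rewrite (_ : L - R = d *+ 2); last by rewrite /d -scaler_nat scalerA mulfV ?scale1r // pnatr_eq0.
  have RE : R = L - d *+ 2.
    by rewrite /d -scaler_nat scalerA mulfV ?scale1r ?subKr // pnatr_eq0.
  rewrite RE => e; rewrite -[RHS](mul0rn _ 2) -oppr0 -{1}e; ring.
have eqx x : (L.[x] - R.[x]) ^+ 2 + (L.[x] + R.[x]) *+ 2 = 0.
  have := congr1 (fun q => q.[x]) eqLR; rewrite horner0 => <-.
  by rewrite (hornerD (_ ^+ 2)) hornerMn horner_exp (hornerD L (- R)) (hornerD L R) hornerN.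
(* The second difference of [eqx] at -1, 0, 1 isolates the coefficient of degree 2 and equals 8 al
   (al l^2 - 1). *)
have alJ : al * l%:R ^+ 2 = 1.
  apply: (mulfI (mulf_neq0 (_ : 8 != 0) al0)); first by rewrite pnatr_eq0.
  have := eqx 1; have := eqx (-1); have := eqx 0; rewrite !hL !hR => e0 e1 e2.
  apply/eqP; rewrite -subr_eq0; apply/eqP.
  transitivity ((0 : K) + 0 - 0 *+ 2); last by rewrite mul0rn subr0 addr0.
  by rewrite -{1}e2 -{1}e1 -{1}e0; ring.
have sL : size L = 3%N.
  rewrite /L size_polyDl size_scale // size_top_u // size_polyC.
  by case: (be != 0).
have lK0 : l%:R != 0 :> K by rewrite pnatr_eq0 -lt0n.
have sd : size d = 2%N.
  have -> : d = (al * l%:R) *: 'X + (al * (l%:R ^+ 2 - l%:R) / 2)%:P.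
    apply/eqP; rewrite -subr_eq0; apply/eqP/node_poly_eq0 => m.
    have dE : d.[node K m] = 2^-1 * (L.[node K m] - R.[node K m]).
      by rewrite /d hornerZ (hornerD L) hornerN.
    rewrite (hornerD d) hornerN dE hL hR hornerD hornerZ hornerX hornerC.
    by field.
  rewrite -mul_polyC size_MXaddC polyC_eq0 mulf_eq0 (negPf al0) (negPf lK0) /=.
  by rewrite size_polyC mulf_neq0.
have topV := @top_model_v _ Q' P' g'.
have [M [b VE]] := span_uvw BV.
have V0 : V != 0.
  apply/eqP => V0; have := topV; rewrite V0 => /(top_uniq (@top0 K 1)) /esym/eqP.
  by rewrite oner_eq0.
have [t1 bt1] := nonzero_coef VE V0.
have [l2 [A [B [AB0 tAB _]]]] := lead_sum l0 sL sd p0 tu tv tw bt1.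
rewrite -VE in tAB; have lp0 := lead_prod_neq0 l p0 l2.
(* V has order 1 with leading coefficient 1, and [lead_sum] gives it the order l l2 with a nonzero
   leading coefficient. *)
have ll2 : (l * l2 = 1)%N.
  case: (ltngtP (l * l2) 1) => // ll2.
    by have /eqP := top_uniq topV (top_lt ll2 tAB); rewrite oner_eq0.
  have /esym/eqP := top_uniq (top_lt ll2 topV) tAB.
  by rewrite mulf_eq0 (negPf lp0) (negPf AB0).
have l1 : l = 1%N by move/eqP: ll2; rewrite muln_eq1 => /andP[/eqP].
have l21 : l2 = 1%N by move/eqP: ll2; rewrite muln_eq1 => /andP[_ /eqP].
subst l l2.
have {}AB0 : (A \Po L) + (B \Po L) * shift 0 d != 0 := AB0.
(* The leading coefficient 1 of V is a multiple of p, so p is constant. *)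
have [ka ka0 pE] : exists2 ka, ka != 0 & p = ka%:P.
  have /esym := top_uniq topV tAB.
  rewrite /lead_prod big_ord1 muln0 shift0 => /(congr1 (fun q : {poly K} => size q)).
  rewrite size_poly1 => /eqP; rewrite size_mul // => sp.
  have sp1 : size p = 1%N.
    have := AB0; have := p0; rewrite -!size_poly_gt0; move: sp.
    case: (size p) => [|[|a]] //; move: (size _) => [|a'] //=.
    by rewrite !addSn addnS.
  exists p`_0; last exact/size1_polyC/eq_leq.
  by apply: contraNneq p0 => p00; rewrite [p](size1_polyC (eq_leq sp1)) p00.
have al1 : al = 1 by move: alJ; rewrite expr1n mulr1.
have be0 : be = 0.
  have := eqx 0; rewrite hL hR al1 => e.
  have : 4 * be = 0 by rewrite -[RHS]e; ring.
  by move/eqP; rewrite mulf_eq0 pnatr_eq0 /= => /eqP.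
have {}uE : u = U by rewrite uE al1 be0 scale1r scale0r addr0.
subst u.
(* The leading terms of order 1 cancel in v - ka V, which is therefore of level 0, a polynomial in
   U. *)
have [A' vE] : exists A', v = ka *: V + horner_alg U A'.
  have [v0|v0] := eqVneq (v - ka *: V) 0.
    by exists 0; rewrite rmorph0 addr0; apply/eqP; rewrite -subr_eq0 v0.
  have AV : gen3 U V W (v - ka *: V).
    rewrite addrC -scaleNr; apply: gen3_lin => //.
    by have := gen3_v (gen3_1 U V W); rewrite mulr1.
  have [M' [a' vE]] := span_UVW AV; have [t2 at2] := nonzero_coef vE v0.
  have [l' [A2 [B2 [AB2 tAB2 l'0]]]] := @model_lead _ Q' P' g' _ _ _ at2.
  have tv0 : top 1 0 (v - ka *: V).
    by have := topB tv (topZ ka topV); rewrite pE -mul_polyC mulr1 subrr.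
  rewrite -vE in tAB2 l'0; case: l' AB2 tAB2 l'0 => [|l'] AB2 tAB2 l'0.
    by exists A2; rewrite -(l'0 erefl).2 addrC subrK.
  have tl0 : top l'.+1 0 (v - ka *: V).
    by case: l' {AB2 tAB2 l'0} => // l'; apply: top_lt tv0.
  by rewrite (top_uniq tAB2 tl0) eqxx in AB2.
have UA : U * horner_alg U A' = horner_alg U A' * U.
  by rewrite -{1 4}[U](horner_algX U) -!rmorphM mulrC.
have wkW : w = ka *: W.
  rewrite wE vE mulrDr mulrDl UA opprD addrACA subrr addr0 -scalerAr -scalerAl -scalerBr.
  rewrite (rel_vu UVW) subKr -scaler_nat !scalerA mulrAC mulVf ?mul1r //.
  by rewrite pnatr_eq0.
(* The relation for [w * u] leaves 2 U A'(U) + ka g' - g = 0. *)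
have [A0 gE] : A' = 0 /\ g = ka * g'.
  have := rel_wu uvw; have := congr1 (fun x => ka *: x) (rel_wu UVW).
  rewrite wkW vE mulrDr -!scalerAl -!scalerAr !scalerBr scalerDr scalerA -!scalerMnr.
  move=> e1 e2; have /horner_alg_eq0 pol : horner_alg U (('X * A') *+ 2 + (ka * g' - g)%:P) = 0.
    rewrite rmorphD rmorphMn rmorphM /= horner_algX horner_algC scalerBl.
    apply: (zmod_cancel e2 e1).
  have coefp i : (('X * A') *+ 2 + (ka * g' - g)%:P)`_i = 0 by rewrite pol coef0.
  split.
    apply/polyP => i; have := coefp i.+1; rewrite coefD coefMn coefXM coefC addr0 coef0.
    by move/eqP; rewrite mulrn_eq0 /= => /eqP.
  have := coefp 0%N; rewrite coefD coefMn coefXM coefC mul0rn add0r => /eqP.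
  by rewrite subr_eq0 eq_sym => /eqP.
have {}vE : v = ka *: V by rewrite vE A0 rmorph0 addr0.
(* All other terms of the relation for [w * w] scale by ka^2. *)
have QQ : Q = ka ^+ 2 *: Q'.
  apply/eqP; rewrite -subr_eq0; apply/eqP/horner_alg_eq0; rewrite rmorphB /= linearZ /=.
  have := rel_ww uvw; have := congr1 (fun x => ka ^+ 2 *: x) (rel_ww UVW).
  rewrite wkW vE gE -!scalerAl -!scalerAr !scalerA -expr2 !scalerBr scalerDr scalerA.
  rewrite -scalerMnr mulrAC -expr2 => -> /addIr /addrI /oppr_inj <-.
  by rewrite mul1r subrr.
have ka2 : ka ^+ 2 = 1.
  move/monicP: Qmonic; rewrite QQ lead_coefZ (monicP Qmonic') mulr1 //.
by rewrite QQ ka2 scale1r gE exprMn ka2 mul1r.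
Qed.

End Rigidity.

(** * Homomorphisms from the free algebra *)

Section Companion.
Variables (K : numFieldType) (N : nat).
Implicit Types Q P : {poly K}.

Lemma horner_companion Q P s : companion_rel Q P ->
  Q.[- (s * (s - 1))] - Q.[- (s * (s + 1))] =
  (s - 1) * P.[- (s * (s - 1))] + (s + 1) * P.[- (s * (s + 1))].
Proof.
move=> /(congr1 (fun q => q.[s])).
by rewrite !(hornerD, hornerN, hornerM, horner_comp, hornerX) -polyC1 !hornerC.
Qed.

Let monic_XDC (e : K) d : ('X + e%:P) ^+ d \is monic.
Proof. by rewrite monic_exp // monicXaddC. Qed.

Let size_XDC (e : K) d : size (('X + e%:P) ^+ d) = d.+1.
Proof. by rewrite -[e]opprK polyCN size_exp_XsubC. Qed.

Let coef_XDC_pred d (e : K) : (('X + e%:P) ^+ d.+1)`_d = e *+ d.+1.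
Proof.
have lead d' : (('X + e%:P) ^+ d')`_d' = 1.
  by have /monicP := monic_XDC e d'; rewrite lead_coefE size_XDC.
elim: d => [|d IHd]; first by rewrite expr1 coefD coefX coefC add0r.
by rewrite exprSr mulrDr coefD coefMC coefMX /= lead IHd mul1r -mulrSr.
Qed.

Let coef_comp_quadratic (e : K) (F : {poly K}) d j : (size F <= d.+1)%N -> (2 * d <= j.+1)%N ->
  (d <= j)%N ->
  (F \Po (- ('X * ('X + e%:P))))`_j = F`_d * (-1) ^+ d * (('X + e%:P) ^+ d)`_(j - d).
Proof.
move=> sF dj dj'; rewrite {1}(_ : F = \sum_(i < d.+1) F`_i *: 'X^i); last first.
  by rewrite -poly_def; apply/polyP => i; rewrite coef_poly; case: ltnP => // di;
    rewrite nth_default // (leq_trans sF).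
have coefq i : ((- ('X * ('X + e%:P))) ^+ i)`_j =
    (-1) ^+ i * (if (j < i)%N then 0 else (('X + e%:P) ^+ i)`_(j - i)).
  by rewrite (exprNn ('X * _)) exprMn -polyC1 -polyCN -polyC_exp coefCM coefXnM.
rewrite linear_sum coef_sum big_ord_recr /= big1 ?add0r => [|i _].
  by rewrite linearZ /= comp_Xn_poly coefZ coefq ltnNge dj' /= mulrA.
rewrite linearZ /= comp_Xn_poly coefZ coefq; case: ltnP => ij; first by rewrite !mulr0.
rewrite [_`_(j - i)]nth_default ?mulr0 // size_XDC.
by have := ltn_ord i; lia.
Qed.

(** Coefficients of degree 2 N + 1 are compared in the companion identity: they are 2 (N + 1) (-1)^N
    on the left and twice the coefficient of [P] times (-1)^N on the right. *)
Lemma companion_coef Q P : Q \is monic -> size Q = N.+2 -> (size P <= N.+1)%N ->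
  companion_rel Q P -> P`_N = N.+1%:R.
Proof.
move=> Qmonic sQ sP; rewrite /companion_rel.
have -> : 'X - 1 = 'X + (-1)%:P :> {poly K} by rewrite polyCN.
have -> : 'X + 1 = 'X + 1%:P :> {poly K} by [].
move=> /(congr1 (fun q : {poly K} => q`_(2 * N).+1)).
have Q1 : Q`_N.+1 = 1 by move/monicP: Qmonic; rewrite lead_coefE sQ.
rewrite !coefB !coefD !mulrDl !coefD !coefCM !coefXM /=.
rewrite !(coef_comp_quadratic _ (eq_leq sQ)) ?(coef_comp_quadratic _ sP); try lia.
have -> : ((2 * N).+1 - N.+1 = N)%N by lia.
have -> : (2 * N - N = N)%N by lia.
have -> : ((2 * N).+1 - N = N.+1)%N by lia.
have lead e : (('X + e%:P : {poly K}) ^+ N)`_N = 1.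
  by have /monicP := monic_XDC e N; rewrite lead_coefE size_XDC.
have lead0 e : (('X + e%:P : {poly K}) ^+ N)`_N.+1 = 0.
  by rewrite nth_default // size_XDC.
rewrite !coef_XDC_pred !lead !lead0 Q1 exprS => e.
have s0 : (-1) ^+ N *+ 2 != 0 :> K by rewrite mulrn_eq0 signr_eq0.
move: (P`_N) e => pN e; apply: (mulfI s0); apply/eqP; rewrite -subr_eq0; apply/eqP.
by move/eqP: e; rewrite -subr_eq0 => /eqP e; rewrite -[RHS]oppr0 -e; ring.
Qed.

End Companion.

(** * Universal property of the free algebra *)

Section FreeAlgebra.
Variable K : numFieldType.
Local Notation A := (free_alg K).
Local Notation gu := (gen_u K).
Local Notation gv := (gen_v K).
Local Notation gw := (gen_w K).

Lemma malgUM (x y : K) (k l : {fmonom 'I_3}) :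
  mkmalgU k x * mkmalgU l y = mkmalgU (mmul k l) (x * y) :> A.
Proof. by rewrite (malgMEw msuppU_le msuppU_le) !big_seq_fset1 !mcoeffUU. Qed.

Lemma malgUZ (x : K) (k : {fmonom 'I_3}) : mkmalgU k x = x *: mkmalgU k 1 :> A.
Proof. by rewrite -mul_malgC malgUM mul1m mulr1. Qed.

Lemma free_alg_ind (T : A -> Prop) : T 1 ->
  (forall x, T x -> T (gu * x)) -> (forall x, T x -> T (gv * x)) ->
  (forall x, T x -> T (gw * x)) ->
  (forall a x y, T x -> T y -> T (a *: x + y)) -> forall x, T x.
Proof.
move=> T1 Tu Tv Tw Tlin x; rewrite (monalgE x).
have T0 : T 0 by rewrite -(addNr (1 : A)) -scaleN1r; apply: Tlin.
elim/big_ind: _ => [//|y z Ty Tz|k _]; first by rewrite -[y]scale1r; apply: Tlin.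
rewrite malgUZ -[_ *: _]addr0; apply: Tlin => //; case: k => s.
elim: s => [|i s IHs].
  by rewrite -fmE; exact: T1.
have -> : mkmalgU (FMonom (i :: s)) 1 = mkmalgU (fmu i) 1 * mkmalgU (FMonom s) 1 :> A.
  by rewrite malgUM mulr1; congr mkmalgU; apply/eqP; rewrite fmP fmM fmU.
case: i => [[|[|[|//]]] i3].
- have -> : Ordinal i3 = 0 by apply/val_inj.
  exact: Tu.
- have -> : Ordinal i3 = 1 by apply/val_inj.
  exact: Tv.
- have -> : Ordinal i3 = 2 by apply/val_inj.
  exact: Tw.
Qed.

Section Evaluation.
Variables (S : lalgType K) (x : 'I_3 -> S).
Hypothesis fx : forall c i, GRing.comm (c%:A) (x i).

Definition word_eval (m : {fmonom 'I_3}) : S := \prod_(i <- m) x i.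

Let word_eval_mmorphism : mmorphism word_eval.
Proof. by split=> [m m'|]; rewrite /word_eval ?fmM ?fm1 ?big_cat ?big_nil. Qed.

HB.instance Definition _ := isMultiplicative.Build {fmonom 'I_3} S word_eval word_eval_mmorphism.

Definition free_eval (y : A) : S := mmap (in_alg S) word_eval y.

(** In a left algebra scalars need not commute with elements, whence [fx]. A left algebra as target
    lets [free_alg] be evaluated in itself, as in [flip]. *)
Lemma free_eval_monoid_morphism : monoid_morphism free_eval.
Proof.
have [|eM e1] := @commr_mmap_is_multiplicative _ _ _ (in_alg S) word_eval; last first.
  by split; [exact: e1 | exact: eM].
by move=> y m m'; apply: commr_prod => i _; apply: fx.
Qed.

Lemma free_eval_linear : linear free_eval.
Proof.
move=> a y z; rewrite /free_eval mmapD; congr (_ + _).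
by rewrite mmapZ /= -scalerAl mul1r.
Qed.

Lemma free_eval_gen i : free_eval (mkmalgU (fmu i) 1) = x i.
Proof. by rewrite /free_eval mmapU /= scale1r mul1r /word_eval fmU big_seq1. Qed.

End Evaluation.

End FreeAlgebra.

Section Homomorphisms.
Variables (K : fieldType) (A S : lalgType K) (F : A -> S).
Hypotheses (Flin : linear F) (Fmon : monoid_morphism F).

Let F1 : F 1 = 1 := Fmon.1.
Let FM : {morph F : x y / x * y} := Fmon.2.
Let F0 : F 0 = 0.
Proof. by have := Flin (-1) 1 1; rewrite !scaleN1r !addNr. Qed.
Let FD : {morph F : x y / x + y}.
Proof. by move=> x y; have := Flin 1 x y; rewrite !scale1r. Qed.
Let FZ a : {morph F : x / a *: x}.
Proof. by move=> x; have := Flin a x 0; rewrite F0 !addr0. Qed.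
Let FN : {morph F : x / - x}.
Proof. by move=> x; rewrite -scaleN1r FZ scaleN1r. Qed.
Let FB : {morph F : x y / x - y}.
Proof. by move=> x y; rewrite FD FN. Qed.
Let FMn n : {morph F : x / x *+ n}.
Proof. by move=> x; rewrite -!scaler_nat FZ. Qed.
Let FX n : {morph F : x / x ^+ n}.
Proof. by move=> x; elim: n => [|n IHn]; rewrite ?expr0 // !exprS FM IHn. Qed.

Lemma hom_horner_in_alg p u :
  F (map_poly (in_alg A) p).[u] = \sum_(i < size p) p`_i *: F u ^+ i.
Proof.
rewrite horner_coef size_map_poly.
elim/big_rec2: _ => [|i y z _ <-]; first exact: F0.
by rewrite FD FM FX coef_map /= FZ F1 -scalerAl mul1r.
Qed.

Lemma hom_rel_uv u v w : F ((u * v - v * u) - 2 * w) = F u * F v - F v * F u - F w *+ 2.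
Proof. by rewrite mulr_natl 2!FB FMn !FM. Qed.

Lemma hom_rel_uw u v w g : F ((u * w - w * u) - (- 2 * (u * v) + 2 * w + g%:A)) =
  F u * F w - F w * F u - (F w *+ 2 - (F u * F v) *+ 2 + g%:A).
Proof.
by rewrite mulNr !mulr_natl 2!FB 2!FD FN !FMn FZ F1 !FM [- _ + _]addrC.
Qed.

Lemma hom_rel_vw v w x : F ((v * w - w * v) - (v ^+ 2 + x)) =
  F v * F w - F w * F v - (F v * F v + F x).
Proof. by rewrite expr2 2!FB FD !FM. Qed.

Lemma hom_rel_ww u v w x g : F (x + u * v ^+ 2 + w ^+ 2 - 2 * (w * v) - g *: v) =
  F x + F u * (F v * F v) + F w * F w - (F w * F v) *+ 2 - g *: F v.
Proof. by rewrite !expr2 mulr_natl 2!FB 2!FD FMn FZ !FM. Qed.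

Lemma hom_ideal_gen (T : classical_sets.set A) t :
  (forall t', T t' -> F t' = 0) -> ideal_gen T t -> F t = 0.
Proof.
move=> FT; elim=> [t' /FT //||t1 t2 _ e1 _ e2|a t' b _ e].
- exact: F0.
- by rewrite FB e1 e2 subrr.
- by rewrite !FM e mulr0 mul0r.
Qed.

End Homomorphisms.

Lemma hom_eq (K : numFieldType) (S : lalgType K) (F G : free_alg K -> S) :
  linear F -> monoid_morphism F -> linear G -> monoid_morphism G ->
  F (gen_u K) = G (gen_u K) -> F (gen_v K) = G (gen_v K) -> F (gen_w K) = G (gen_w K) ->
  F =1 G.
Proof.
move=> Flin [F1 FM] Glin [G1 GM] uE vE wE; elim/free_alg_ind => [|x xE|x xE|x xE|a x y xE yE].
- by rewrite F1 G1.
- by rewrite FM GM uE xE.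
- by rewrite FM GM vE xE.
- by rewrite FM GM wE xE.
- by rewrite Flin Glin xE yE.
Qed.

Section AlgebraHomomorphisms.
Variables (K : numClosedFieldType) (E : algType K) (F : free_alg K -> E).
Hypotheses (Flin : linear F) (Fmon : monoid_morphism F).
Local Notation u := (F (gen_u K)).
Local Notation v := (F (gen_v K)).
Local Notation w := (F (gen_w K)).

Lemma hom_gen3 x : gen3 u v w (F x).
Proof.
have [F1 FM] := Fmon; elim/free_alg_ind: x => [|x IH|x IH|x IH|a x y IHx IHy].
- by rewrite F1; apply: gen3_1.
- by rewrite FM; apply: gen3_u.
- by rewrite FM; apply: gen3_v.
- by rewrite FM; apply: gen3_w.
- by rewrite Flin; apply: gen3_lin.
Qed.

Lemma hom_eval_u p : F (eval_u p) = horner_alg u p.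
Proof. by rewrite (horner_alg_sum _ (leqnn _)) -(hom_horner_in_alg Flin Fmon). Qed.

Lemma relatorsP Q g : (forall x, relator Q g x -> F x = 0) <->
  relations Q (companion Q) g u v w.
Proof.
split=> [F0|[vu wu wv ww] x].
  split.
  - have := F0 _ (Relator_uv Q g); rewrite (hom_rel_uv Flin Fmon).
    by move/subr0_eq => <-; rewrite subKr.
  - have := F0 _ (Relator_uw Q g); rewrite (hom_rel_uw Flin Fmon).
    move/subr0_eq; move: (u * w) (w * u) (w *+ 2) (u * v *+ 2) (g%:A) => a b c d e abc.
    by rewrite -[LHS](subKr a) abc -!addrA !opprD !opprK; congr (_ + _); rewrite addrCA.
  - have := F0 _ (Relator_vw Q g); rewrite (hom_rel_vw Flin Fmon) hom_eval_u.
    move/subr0_eq; move: (v * w) (w * v) (v * v) (horner_alg _ _) => a b c d abc.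
    by rewrite -[LHS](subKr a) abc opprD addrA.
  - have := F0 _ (Relator_Q Q g); rewrite (hom_rel_ww Flin Fmon) hom_eval_u.
    move: (horner_alg _ _) (u * _) (w * w) (w * v *+ 2) (_ *: v) => a b c d e.
    move/eqP; rewrite !subr_eq add0r => /eqP abc.
    have -> : c = a + b + c - (a + b) by rewrite [a + b + c]addrC addrK.
    by rewrite abc opprD addrA [e + d]addrC.
case.
- by rewrite (hom_rel_uv Flin Fmon) vu subKr subrr.
- rewrite (hom_rel_uw Flin Fmon) wu.
  move: (u * w) (w *+ 2) (u * v *+ 2) (g%:A) => a b c d.
  have -> : a + c - b - d = a - (b - c + d).
    by rewrite -!addrA !opprD !opprK; congr (_ + _); rewrite addrCA.
  by rewrite subKr subrr.
- rewrite (hom_rel_vw Flin Fmon) hom_eval_u wv.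
  move: (v * w) (v * v) (horner_alg _ _) => a b c.
  by have -> : a - b - c = a - (b + c); rewrite ?subKr ?subrr // opprD addrA.
- rewrite (hom_rel_ww Flin Fmon) hom_eval_u ww.
  move: (horner_alg _ _) (u * _) (w * v *+ 2) (_ *: v) => a b c d.
  have -> : c + d - a - b = c + d - (a + b) by rewrite opprD addrA.
  by rewrite [a + b + _]addrC subrK -(addrA (c + d)) -opprD subrr.
Qed.

End AlgebraHomomorphisms.

Section Isomorphisms.
Variable K : numClosedFieldType.

(** The operator model gives a representation [rho] of the second algebra. Composed with the
    isomorphism, it yields a second triple of operators, which satisfies the relations of the first
    algebra and generates the same subalgebra because f is onto. *)
Lemma algD_isom_invariants (N : nat) (Q Q' : {poly K}) (g g' : K) : (3 <= N)%N ->
  Q \is monic -> size Q = N.+2 -> Q' \is monic -> size Q' = N.+2 ->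
  algD_isom Q g Q' g' -> Q = Q' /\ g ^+ 2 = g' ^+ 2.
Proof.
move=> N3 Qmonic sQ Qmonic' sQ' [f [flin [f1 fM] [h fK hK]]].
have [|sP QP] := @companionP _ Q; first by rewrite sQ.
have [|sP' QP'] := @companionP _ Q'; first by rewrite sQ'.
rewrite sQ in sP; rewrite sQ' in sP'.
have PN' := companion_coef Qmonic' sQ' (eq_leq sP') QP'.
have hQP' s := horner_companion s QP'.
pose P' := companion Q'.
pose x (i : 'I_3) : endo K := nth 0 [:: model_u K; model_v Q' P' g'; model_w Q' P' g'] i.
have xC c i : GRing.comm (c%:A) (x i).
  by rewrite /GRing.comm -scalerAl -scalerAr mul1r mulr1.
pose F := free_eval x.
have Flin : linear F := free_eval_linear x.
have Fmon : monoid_morphism F := free_eval_monoid_morphism xC.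
have Fu : F (gen_u K) = model_u K := free_eval_gen x 0.
have Fv : F (gen_v K) = model_v Q' P' g' := free_eval_gen x 1.
have Fw : F (gen_w K) = model_w Q' P' g' := free_eval_gen x 2.
have Frel y : relator Q' g' y -> F y = 0.
  by apply: (relatorsP Flin Fmon Q' g').2; rewrite Fu Fv Fw; apply: model_relations.
pose rho (z : algD Q' g') := F (repr z).
have rhoE y : rho (\pi_(algD Q' g') y) = F y.
  apply/eqP; rewrite -subr_eq0 /rho.
  have -> : F (repr (\pi_(algD Q' g') y)) - F y = F (repr (\pi_(algD Q' g') y) - y).
    have := Flin (-1) y (repr (\pi_(algD Q' g') y)).
    by rewrite !scaleN1r [- y + _]addrC [- F y + _]addrC.
  apply/eqP; apply: (hom_ideal_gen Flin Fmon Frel).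
  by apply/eq_quot_alg; rewrite reprK.
have rholin : linear rho.
  move=> a; elim/quotW=> y; elim/quotW=> z.
  by rewrite -pi_quot_algZ -pi_quot_algD !rhoE Flin.
have rhomon : monoid_morphism rho.
  split; first by rewrite -[1]pi_quot_alg1 rhoE Fmon.1.
  by elim/quotW=> y; elim/quotW=> z; rewrite -pi_quot_algM !rhoE Fmon.2.
pose G y := rho (f (\pi_(algD Q g) y)).
have Glin : linear G.
  by move=> a y z; rewrite /G pi_quot_algD pi_quot_algZ flin rholin.
have Gmon : monoid_morphism G.
  by split=> [|y z]; rewrite /G ?pi_quot_alg1 ?f1 ?rhomon.1 // pi_quot_algM fM rhomon.2.
have Grel y : relator Q g y -> G y = 0.
  move=> rel_y; rewrite /G; have -> : \pi_(algD Q g) y = \pi_(algD Q g) 0.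
    by apply/eq_quot_alg; rewrite subr0; apply: IdealGen.
  by have := Glin (-1) 0 0; rewrite scaler0 addr0 scaleN1r addNr.
have onto y : exists z, F y = G z.
  by exists (repr (h (\pi_(algD Q' g') y))); rewrite /G reprK hK rhoE.
have AF y : gen3 (model_u K) (model_v Q' P' g') (model_w Q' P' g') (G y).
  by rewrite -Fu -Fv -Fw; apply: (hom_gen3 Flin Fmon).
have BG y : gen3 (G (gen_u K)) (G (gen_v K)) (G (gen_w K)) (F y).
  by have [z ->] := onto y; apply: (hom_gen3 Glin Gmon).
apply: (rigidity N3 Qmonic' sQ' (eq_leq sP') PN' hQP' Qmonic sQ (eq_leq sP)
  ((relatorsP Glin Gmon Q g).1 Grel)) => //.
- by rewrite -Fu.
- by rewrite -Fv.
Qed.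

End Isomorphisms.

(** * The moduli space *)

Section SignChange.
Variables (K : fieldType) (A S : lalgType K) (F : A -> S).
Hypotheses (Flin : linear F) (Fmon : monoid_morphism F).

Lemma hom_0 : F 0 = 0.
Proof. by have := Flin (-1) 0 0; rewrite scaler0 addr0 scaleN1r addNr. Qed.

Lemma hom_opp x : F (- x) = - F x.
Proof. by have := Flin (-1) x 0; rewrite hom_0 !addr0 !scaleN1r. Qed.

Lemma hom_sub x y : F (x - y) = F x - F y.
Proof. by have := Flin 1 x (- y); rewrite !scale1r hom_opp. Qed.

Variables (u v w x : A) (u' v' w' x' : S) (g : K).
Hypotheses (Fu : F u = u') (Fv : F v = - v') (Fw : F w = - w') (Fx : F x = x').

Lemma sign_rel_uv : F ((u * v - v * u) - 2 * w) = - ((u' * v' - v' * u') - 2 * w').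
Proof.
by rewrite (hom_rel_uv Flin Fmon) Fu Fv Fw mulrN mulNr mulr_natl mulNrn !opprB !opprK addrC
  [- _ + _]addrC.
Qed.

Lemma sign_rel_uw : F ((u * w - w * u) - (- 2 * (u * v) + 2 * w + g%:A)) =
  - ((u' * w' - w' * u') - (- 2 * (u' * v') + 2 * w' + (- g)%:A)).
Proof.
rewrite (hom_rel_uw Flin Fmon) Fu Fv Fw !mulrN !mulNr !mulr_natl !mulNrn scaleNr !opprK.
move: (u' * w') (w' * u') (u' * v' *+ 2) (w' *+ 2) (g%:A) => a b c d e.
have -> : - c + d - e = - (- d + c + e) by rewrite !opprD opprK [- c + d]addrC.
by move: (- d + c + e) => z; rewrite opprK opprD opprB [- a + b]addrC.
Qed.

Lemma sign_rel_vw : F ((v * w - w * v) - (v ^+ 2 + x)) =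
  (v' * w' - w' * v') - (v' ^+ 2 + x').
Proof. by rewrite (hom_rel_vw Flin Fmon) Fv Fw Fx !mulrNN expr2. Qed.

Lemma sign_rel_ww : F (x + u * v ^+ 2 + w ^+ 2 - 2 * (w * v) - g *: v) =
  x' + u' * v' ^+ 2 + w' ^+ 2 - 2 * (w' * v') - (- g) *: v'.
Proof. by rewrite (hom_rel_ww Flin Fmon) Fu Fv Fw Fx !mulrNN !expr2 mulr_natl scaleNr scalerN. Qed.

End SignChange.

Section SignIsomorphism.
Variable K : numClosedFieldType.
Local Notation A := (free_alg K).
Local Notation u := (gen_u K).
Local Notation v := (gen_v K).
Local Notation w := (gen_w K).

Let gen_comm c j : GRing.comm (c%:A : A) (mkmalgU (fmu j) 1).
Proof.
rewrite /GRing.comm -(malgUZ c mone) (malgUM c 1) (malgUM 1 c).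
by rewrite mul1m mulm1 mulr1 mul1r.
Qed.

Let y (i : 'I_3) : A := nth 0 [:: u; - v; - w] i.

Let yC c i : GRing.comm (c%:A) (y i).
Proof.
case: i => [[|[|[|i]]] i3]; last by case: (notF i3).
- exact: gen_comm.
- exact: commrN (gen_comm c 1).
- exact: commrN (gen_comm c 2).
Qed.

(** Under v to - v, w to - w, g to - g, the first two relators change sign and the last two are
    kept. *)
Definition flip : A -> A := free_eval y.

Let flip_lin : linear flip := free_eval_linear y.
Let flip_mon : monoid_morphism flip := free_eval_monoid_morphism yC.
Let flip_u : flip u = u := free_eval_gen y 0.
Let flip_v : flip v = - v := free_eval_gen y 1.
Let flip_w : flip w = - w := free_eval_gen y 2.

Lemma flipK : involutive flip.
Proof.
have lin : linear (flip \o flip).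
  by move=> a x z; rewrite /comp (flip_lin a x z) (flip_lin a).
have mon : monoid_morphism (flip \o flip).
  split=> [|x z]; rewrite /comp ?flip_mon.1 ?flip_mon.1 //.
  by rewrite (flip_mon.2 x z) (flip_mon.2 (flip x)).
have idlin : linear (@id A) by move=> a x z.
have idmon : monoid_morphism (@id A) by split.
apply: (hom_eq lin mon idlin idmon); rewrite /comp.
- by rewrite flip_u flip_u.
- by rewrite flip_v (hom_opp flip_lin) flip_v opprK.
- by rewrite flip_w (hom_opp flip_lin) flip_w opprK.
Qed.

Let flip_eval p : flip (eval_u p) = eval_u p.
Proof.
have idlin : linear (@id A) by move=> a x z.
have idmon : monoid_morphism (@id A) by split.
have := hom_horner_in_alg flip_lin flip_mon p u; rewrite flip_u => ->.
exact/esym/(hom_horner_in_alg idlin idmon p u).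
Qed.

Let ideal_opp (T : classical_sets.set A) x : ideal_gen T x -> ideal_gen T (- x).
Proof. by move=> xI; rewrite -sub0r; apply: IdealB => //; apply: Ideal0. Qed.

Lemma flip_relator Q g x : relator Q g x -> ideal_gen (relator Q (- g)) (flip x).
Proof.
case.
- rewrite (sign_rel_uv flip_lin flip_mon flip_u flip_v flip_w).
  exact/ideal_opp/IdealGen/Relator_uv.
- rewrite (sign_rel_uw flip_lin flip_mon g flip_u flip_v flip_w).
  exact/ideal_opp/IdealGen/Relator_uw.
- rewrite (sign_rel_vw flip_lin flip_mon flip_v flip_w (flip_eval _)).
  exact/IdealGen/Relator_vw.
- rewrite (sign_rel_ww flip_lin flip_mon g flip_u flip_v flip_w (flip_eval _)).
  exact/IdealGen/Relator_Q.
Qed.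

Let flip_ideal Q g x : ideal_gen (relator Q g) x -> ideal_gen (relator Q (- g)) (flip x).
Proof.
elim=> {x} [x /flip_relator //||x z _ xI _ zI|a x b _ xI].
- by rewrite (hom_0 flip_lin); apply: Ideal0.
- by rewrite (hom_sub flip_lin); apply: IdealB.
- by rewrite (flip_mon.2 (a * x) b) (flip_mon.2 a x); apply: IdealM.
Qed.

(** The target parameter is a variable [h], so that the inverse map lands in the algebra of [g]
    itself and not of [- - g]. *)
Let flip_quot Q g h (z : algD Q g) : algD Q h := \pi_(algD Q h) (flip (repr z)).

Let flip_quotE Q g h x : h = - g ->
  @flip_quot Q g h (\pi_(algD Q g) x) = \pi_(algD Q h) (flip x).
Proof.
move=> ->; apply/eq_quot_alg; rewrite -(hom_sub flip_lin).
by apply: flip_ideal; apply/eq_quot_alg; rewrite reprK.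
Qed.

Lemma algD_isom_opp (Q : {poly K}) (g h : K) : h = - g -> algD_isom Q g Q h.
Proof.
move=> hg; have gh : g = - h by rewrite hg opprK.
exists (@flip_quot Q g h); split.
- move=> a; elim/quotW=> x; elim/quotW=> z.
  rewrite -pi_quot_algZ -pi_quot_algD !(flip_quotE _ _ hg) flip_lin.
  by rewrite pi_quot_algD pi_quot_algZ.
- split; first by rewrite -[1]pi_quot_alg1 (flip_quotE _ _ hg) flip_mon.1.
  elim/quotW=> x; elim/quotW=> z; rewrite -pi_quot_algM !(flip_quotE _ _ hg) (flip_mon.2 x z).
  by rewrite pi_quot_algM.
exists (@flip_quot Q h g) => z; elim/quotW: z => x.
  by rewrite (flip_quotE _ _ hg) (flip_quotE _ _ gh) flipK.
by rewrite (flip_quotE _ _ gh) (flip_quotE _ _ hg) flipK.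
Qed.

End SignIsomorphism.

(** * The coefficients of Q and gamma^2 as coordinates *)

Section Moduli.
(* Only for the ring structure of [mpoly]: its notations clash with [monalg]. *)
Import -(notations) mpoly.
Variables (K : numClosedFieldType) (n : nat).
Hypothesis n5 : (5 <= n)%N.

Lemma param_eqP (x y : param K n) :
  param_eq x y <-> val x.1 = val y.1 /\ x.2 ^+ 2 = y.2 ^+ 2.
Proof.
have [N N3 nE] : exists2 N, (3 <= N)%N & n = N.+2 by exists n.-2; lia.
case: x y => [[Q /= QP] g] [[Q' /= QP'] g'] /=; split=> [/asboolP|[/= QQ gg]].
  have [Qmonic sQ] : Q \is monic /\ size Q = N.+2 by case/andP: QP => ? /eqP ->.
  have [Qmonic' sQ'] : Q' \is monic /\ size Q' = N.+2 by case/andP: QP' => ? /eqP ->.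
  by move=> /= /(algD_isom_invariants N3 Qmonic sQ Qmonic' sQ').
apply/asboolP => /=; rewrite QQ; move/eqP: gg; rewrite eqf_sqr => /orP[/eqP ->|/eqP gg].
  exact: algD_isom_refl.
by apply: algD_isom_opp; rewrite gg opprK.
Qed.

Definition invariants (x : param K n) : 'rV[K]_n :=
  \row_i if (i < n.-1)%N then (val x.1)`_i else x.2 ^+ 2.

Lemma invariantsP x y : invariants x = invariants y <-> param_eq x y.
Proof.
rewrite param_eqP; split=> [/rowP xy|[Qxy gxy]]; last first.
  by apply/rowP => i; rewrite !mxE Qxy gxy.
have n0 : (n.-1 < n)%N by lia.
split; last by have := xy (Ordinal n0); rewrite !mxE /= ltnn.
have sz (z : param K n) : size (val z.1) = n by case/andP: (valP z.1) => _ /eqP.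
have lc (z : param K n) : (val z.1)`_n.-1 = 1.
  by case/andP: (valP z.1) => /monicP; rewrite lead_coefE sz.
apply/polyP => i; case: (ltngtP i n.-1) => [ilt|ilt|->].
- have ni : (i < n)%N by lia.
  by have := xy (Ordinal ni); rewrite !mxE /= ilt.
- by rewrite !nth_default ?sz //; lia.
- by rewrite !lc.
Qed.

Let last_lt : (n.-1 < n)%N. Proof. by lia. Qed.
Let last : 'I_n := Ordinal last_lt.

(** Degree n - 1 receives the leading coefficient 1. [insub] succeeds for every i < n, so the
    default 0 never occurs. *)
Definition row_poly (r : 'rV[K]_n) : {poly K} :=
  \poly_(i < n) (if insub i is Some j then if (i < n.-1)%N then r 0 j else 1 else 0).

Lemma row_polyP r : (row_poly r \is monic) && (size (row_poly r) == n).
Proof.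
have top : (row_poly r)`_n.-1 = 1.
  by rewrite coef_poly last_lt insubT /= ltnn.
have s : size (row_poly r) = n.
  apply/eqP; rewrite eqn_leq size_poly /=.
  by rewrite -(ltn_predK last_lt) ltnNge; apply/negP => /leq_sizeP/(_ _ (leqnn _)) /eqP;
    rewrite top oner_eq0.
by rewrite s eqxx andbT monicE lead_coefE s top.
Qed.

Definition row_param (r : 'rV[K]_n) : param K n :=
  (exist _ (row_poly r) (row_polyP r), sqrtC (r 0 last)).

Lemma row_paramK r : invariants (row_param r) = r.
Proof.
apply/rowP => i; rewrite !mxE /=; case: ifP => ilt.
  by rewrite coef_poly ltn_ord valK ilt.
rewrite sqrtCK; congr (r 0 _); apply/val_inj => /=.
by have := ltn_ord i; lia.
Qed.

Lemma meval_sqr (p : mpoly.mpoly n K) : exists q : mpoly.mpoly n K, forall x : param K n,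
  mpoly.meval (param_coord x) q = mpoly.meval (fun i => invariants x 0 i) p.
Proof.
pose lq : n.-tuple (mpoly.mpoly n K) := [tuple (if (i < n.-1)%N
  then mpoly.mpolyX K (mpoly.mnm1 i) else mpoly.mpolyX K (mpoly.mnm1 i) ^+ 2) | i < n].
exists (mpoly.comp_mpoly lq p) => x; rewrite mpoly.comp_mpoly_meval.
apply: mpoly.meval_eq => i; rewrite tnth_mktuple mxE.
by case: ifP => ilt; rewrite ?rmorphXn /= mpoly.mevalXU /param_coord ilt.
Qed.

(* The part of [p] of even degree in the last variable, as a polynomial in its
   square. *)
Definition even_part (p : mpoly.mpoly n K) : mpoly.mpoly n K :=
  \sum_(m <- mpoly.msupp p | ~~ odd (m last))
    mpoly.mcoeff m p *: \prod_(i < n) mpoly.mpolyX K (mpoly.mnm1 i) ^+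
      (if i == last then (m i)./2 else m i).

(** In the sum of the values at t and - t, monomials of odd degree in the last variable cancel and
    the others double. *)
Lemma meval_even_part (p : mpoly.mpoly n K) (a b : 'I_n -> K) (t : K) :
  (forall i, i != last -> a i = b i) -> a last = t -> b last = t ^+ 2 ->
  mpoly.meval b (even_part p) *+ 2 =
  mpoly.meval a p + mpoly.meval (fun i => if i == last then - t else a i) p.
Proof.
move=> ab at_ bt; rewrite /even_part raddf_sum /= !(mpoly.mevalE _ p) -big_split /=.
rewrite -sumrMnl big_mkcond /=; apply: eq_bigr => m _.
have splitl (F : 'I_n -> K) : \prod_i F i = F last * \prod_(i < n | i != last) F i.
  by rewrite (bigD1 last).
rewrite -mulrDr (splitl (fun i => a i ^+ m i)) splitl eqxx at_.
have -> : \prod_(i < n | i != last) (if i == last then - t else a i) ^+ m i =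
          \prod_(i < n | i != last) a i ^+ m i.
  by apply: eq_bigr => i /negPf ->.
have ar : \prod_(i < n | i != last) b i ^+ (if i == last then (m i)./2 else m i) =
          \prod_(i < n | i != last) a i ^+ m i.
  by apply: eq_bigr => i il; rewrite (negPf il) ab.
rewrite -mulrDl exprNn -signr_odd; case: ifP => om.
  rewrite mpoly.mevalZ rmorph_prod /=.
  under eq_bigr do rewrite rmorphXn /= mpoly.mevalXU.
  rewrite splitl.
  rewrite ar eqxx bt -exprM mul2n halfK (negPf om) subn0 expr0.
  by ring.
by rewrite (negbFE om) expr1 mulN1r subrr mul0r mulr0.
Qed.

Lemma moduli_class_eq (x y : param K n) :
  moduli_class x = moduli_class y <-> invariants x = invariants y.
Proof.
rewrite invariantsP; split=> [xy|xy].
  by rewrite -[param_eq x y]/(param_equiv K n x y); apply/eqmodP.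
by apply/eqmodP.
Qed.

Lemma moduli_isom_row : moduli_isom_vector_space K n.
Proof.
pose phi (c : moduli K n) := invariants (repr c).
have phiE x : phi (moduli_class x) = invariants x.
  by apply/moduli_class_eq; rewrite /moduli_class reprK.
exists phi.
  exists (fun r => moduli_class (row_param r)) => [|r]; last by rewrite phiE row_paramK.
  elim/quotW=> x; rewrite -/(moduli_class x) phiE.
  by apply/moduli_class_eq; rewrite row_paramK.
move=> f; split=> [[p fp]|[p fp]].
  have [q qE] := meval_sqr p; exists q => x.
  by rewrite /= fp phiE qE.
exists (even_part p) => r.
(* Both parameters have invariants r, so p takes the value f(r) at each of them, and the mean of the
   two values comes from the even part of p. *)
pose x := row_param r; pose x' : param K n := (x.1, - x.2).
have xr := row_paramK r.
have x'r : invariants x' = r.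
  by rewrite -xr; apply/rowP => i; rewrite !mxE /= sqrrN.
have lastE i : (i == last) = ~~ (i < n.-1)%N.
  by rewrite -val_eqE /=; have := ltn_ord i; lia.
have x'E : mpoly.meval (param_coord x') p =
    mpoly.meval (fun i => if i == last then - x.2 else param_coord x i) p.
  by apply: mpoly.meval_eq => i; rewrite lastE /param_coord; case: ifP.
have two0 : 2 != 0 :> K by rewrite pnatr_eq0.
apply: (mulIf two0); rewrite !mulr_natr.
rewrite (@meval_even_part p (param_coord x) (fun i => r 0 i) x.2) => [|i il||].
- have := fp x; have := fp x'; rewrite /= !phiE xr x'r x'E => <- <-.
  by rewrite mulr2n.
- by rewrite -[in RHS]xr mxE /param_coord; move: il; rewrite lastE negbK => ->.
- by rewrite /param_coord ltnn.
- by rewrite sqrtCK.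
Qed.

End Moduli.

Theorem corollary3p23 (R : realType) (n : nat) (n5 : (5 <= n)%N) :
  moduli_isom_vector_space R[i] n.
Proof. exact: moduli_isom_row. Qed.
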